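(* Let $n\ge 1$, $p\in(1,\infty)$ and $\lambda>1$, and let $\mathcal{Q}$ be a family of convex bodies in $\mathbb{R}^n$ that is exhaustive and $\lambda$-dense. Then $$\|M_{\mathcal{Q}}f\|_{L^p(\mathbb{R}^n)}\ \ge\ \left(\frac{\lambda^{p}-1}{\lambda^{p}-\lambda}\right)^{1/p}\|f\|_{L^p(\mathbb{R}^n)}\qquad\text{for all } f\in L^p(\mathbb{R}^n)\text{ with } f\ge 0 .$$
   Context: A convex body in $\mathbb{R}^n$ is a compact convex set with non-empty interior. For a measurable set $A$ with $|A|>0$ write $\langle f\rangle_A=\frac{1}{|A|}\int_A f$ ($|\cdot|$ is Lebesgue measure), and set $\langle f\rangle_A=0$ if $|A|=0$. For a family $\mathcal{Q}$ of convex bodies in $\mathbb{R}^n$, the associated maximal function is $$M_{\mathcal{Q}}f(x)=\sup_{Q\in\mathcal{Q}:\ Q\ni x}\langle f\rangle_Q .$$ The family $\mathcal{Q}$ is *exhaustive* if for every compact $E\subset\mathbb{R}^n$ there exists $Q\in\mathcal{Q}$ with $E\subset Q$. The family $\mathcal{Q}$ is *$\lambda$-dense* (where $\lambda>1$) if for every locally integrable $f\ge 0$ and every $Q\in\mathcal{Q}$ there exists a sequence $\{\mathcal{F}_m\}_{m=0}^\infty$ (a filtration associated to $Q$ and $f$) such that: 1. $\mathcal{F}_0=\{Q\}$. 2. For every $m\ge 0$, $\mathcal{F}_m$ consists of at most countably many sets from $\mathcal{Q}$. 3. $Q=\bigcup_{P\in\mathcal{F}_m}P$ for every $m\ge 0$.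 4. The elements of $\mathcal{F}_m$ are almost disjoint: $|P\cap R|=0$ for any two different $P,R\in\mathcal{F}_m$ and every $m\ge 1$. 5. $\mathcal{F}_{m+1}$ is a refinement of $\mathcal{F}_m$: for every $P\in\mathcal{F}_m$ there is a family of sets $\mathrm{ch}(P)\subset\mathcal{F}_{m+1}$ such that $P=\bigcup_{R\in\mathrm{ch}(P)}R$. 6. $\lim_{m\to\infty}\sup_{P\in\mathcal{F}_m}\mathrm{diam}(P)=0$. 7. $\sup_{R\in\mathrm{ch}(P)}\langle f\rangle_R\le\lambda\langle f\rangle_P$ for every $P\in\mathcal{F}_m$ and every $m\ge 0$. *)

(* Defs.v *)
From HB Require Import structures.
From mathcomp Require Import all_boot all_order all_algebra.
From mathcomp Require Import all_classical all_reals all_analysis.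

Set Implicit Arguments.
Unset Strict Implicit.
Unset Printing Implicit Defensive.
Import Order.TTheory GRing.Theory Num.Theory.
Import numFieldNormedType.Exports.

Local Open Scope classical_set_scope.
Local Open Scope ring_scope.

(* The dimension is [n.+1], so that [n : nat] ranges over all dimensions >= 1;
   vectors carry the (product) topology of ['rV[R]_n.+1].                     *)

Section lebesgue_outer_measure.
Context {R : realType} {n : nat}.
Implicit Types (a b : 'rV[R]_n.+1) (E : set 'rV[R]_n.+1).

Definition box a b : set 'rV[R]_n.+1 :=
  [set x | forall i, a 0 i <= x 0 i <= b 0 i].

(* The maximum makes the volume of an empty box (b 0 i < a 0 i for some i) 0. *)
Definition box_volume a b : R := \prod_i Num.max 0 (b 0 i - a 0 i).

Definition box_cover E : set ('rV[R]_n.+1 * 'rV[R]_n.+1)^nat :=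
  [set B | E `<=` \bigcup_k box (B k).1 (B k).2].

Definition lebesgue_outer E : \bar R :=
  ereal_inf [set \sum_(k <oo) (box_volume (B k).1 (B k).2)%:E
            | B in box_cover E]%E.

Lemma box_volume_ge0 a b : 0 <= box_volume a b.
Proof. by apply: prodr_ge0 => i _; rewrite le_max lexx. Qed.

Let volE (B : 'rV[R]_n.+1 * 'rV[R]_n.+1) : \bar R :=
  (box_volume B.1 B.2)%:E.

Let volE_ge0 B : (0 <= volE B)%E.
Proof. by rewrite lee_fin box_volume_ge0. Qed.

Lemma lebesgue_outer_ge0 E : (0 <= lebesgue_outer E)%E.
Proof.
by apply: le_ereal_inf_tmp => _ [B _ <-]; apply: nneseries_ge0 => k _ _; exact: volE_ge0.
Qed.

Lemma le_lebesgue_outer :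
  {homo lebesgue_outer : A B / A `<=` B >-> (A <= B)%E}.
Proof.
move=> A B AB; apply/ereal_inf_le_tmp => _ [C BC <-].
by exists C => //; exact: subset_trans BC.
Qed.

Lemma lebesgue_outer0 : lebesgue_outer set0 = 0%E.
Proof.
apply/eqP; rewrite eq_le lebesgue_outer_ge0 andbT.
apply: ereal_inf_lbound; exists (fun=> (0, 0)); first exact: sub0set.
rewrite eseries0// => k _ _.
by rewrite /box_volume big_ord_recl /= !mxE subrr maxxx mul0r.
Qed.

Lemma lebesgue_outer_sigma_subadditive : sigma_subadditive lebesgue_outer.
Proof.
move=> A; have [[i ioo]|] := pselect (exists i, lebesgue_outer (A i) = +oo%E).
  rewrite (eseries_pinfty _ _ ioo) ?leey// => m _.
  by rewrite -ltNye (lt_le_trans _ (lebesgue_outer_ge0 _)).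
rewrite -forallNE => Aoo.
apply/lee_addgt0Pr => _/posnumP[e].
rewrite (le_trans _ (epsilon_trick _ _ _))//; last first.
  by move=> m; exact: lebesgue_outer_ge0.
pose P m B := box_cover (A m) B /\
  (\sum_(k <oo) volE (B k) <=
   lebesgue_outer (A m) + (e%:num / (2 ^ m.+1)%:R)%:E)%E.
have [G PG] : {G & forall m, P m (G m)}.
  apply: (@choice _ _ P) => m; rewrite /P /lebesgue_outer.
  set S := (X in ereal_inf X); move infS : (ereal_inf S) => iS.
  case: iS infS => [r Sr|Soo|Soo].
  - have en1 : 0 < e%:num / (2 ^ m.+1)%:R by [].
    have /(lb_ereal_inf_adherent en1) : ereal_inf S \is a fin_num by rewrite Sr.
    move=> [x [B AB volx] xS].
    by exists B; split => //; rewrite -Sr; apply/ltW; rewrite volx.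
  - by have := Aoo m; rewrite /lebesgue_outer Soo.
  - have := lebesgue_outer_ge0 (A m).
    by rewrite /lebesgue_outer -/S Soo.
have volG_ge0 x : (0 <= (volE \o uncurry G) x)%E by exact: volE_ge0.
apply: (@le_trans _ _ (\esum_(i in setT) (volE \o uncurry G) i)%E).
  have /card_esym/ppcard_eqP[f] := card_nat2.
  apply: ereal_inf_lbound; exists (uncurry G \o f).
    move=> t [i _] /(PG i).1[j _ Bijt]; exists (f^-1%FUN (i, j)) => //=.
    by rewrite invK ?inE.
  rewrite -(esum_pred_image (volE \o uncurry G) _ xpredT) ?[fun=> _]set_true//.
  by rewrite image_eq.
rewrite (_ : esum _ _ = \sum_(i <oo) \sum_(j <oo) volE (G i j))%E; last first.
  pose J : nat -> set (nat * nat) := fun i => [set (i, j) | j in setT].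
  rewrite (_ : setT = \bigcup_k J k); last first.
    by rewrite predeqE => -[a b]; split => // _; exists a => //; exists b.
  rewrite esum_bigcupT /=; last 2 first.
    - apply/trivIsetP => i j _ _ ij.
      rewrite predeqE => -[k m] /=; split => //= -[] [_] _ [<-{k} _].
      by move=> [m' _] [] /esym/eqP; rewrite (negbTE ij).
    - by [].
  rewrite -(image_id [set: nat]) -fun_true esum_pred_image//; last first.
    by move=> k _; exact: esum_ge0.
  apply: eq_eseriesr => /= j _.
  rewrite -(esum_pred_image (volE \o uncurry G) (pair j) predT)//=; last first.
    by move=> ? ? _ _; exact: (@can_inj _ _ _ snd).
  by congr esum; rewrite predeqE => -[a b]; split; move=> [i _ <-]; exists i.
apply: lee_lim.
- by apply: is_cvg_nneseries => k _ _; exact: nneseries_ge0.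
- by apply: is_cvg_nneseries => k _ _; rewrite adde_ge0 ?lebesgue_outer_ge0.
- by near=> m; apply: lee_sum => k _; exact: (PG k).2.
Unshelve. all: by end_near. Qed.

HB.instance Definition _ := isOuterMeasure.Build R 'rV[R]_n.+1 lebesgue_outer
  lebesgue_outer0 lebesgue_outer_ge0 le_lebesgue_outer
  lebesgue_outer_sigma_subadditive.

End lebesgue_outer_measure.

(* R^(n+1) with the sigma-algebra of all Lebesgue measurable sets, i.e. the
   Caratheodory measurable sets of the Lebesgue outer measure.                *)
Notation lebesgue_space R n :=
  (caratheodory_type (@lebesgue_outer R n : set 'rV[R]_n.+1 -> \bar R)).

Definition lebesgue_measure_rV (R : realType) (n : nat) :
  set (lebesgue_space R n) -> \bar R := @lebesgue_outer R n.

HB.instance Definition _ (R : realType) (n : nat) :=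
  isMeasure.Build _ (lebesgue_space R n) R (@lebesgue_measure_rV R n)
    (@caratheodory_measure0 R 'rV[R]_n.+1 (@lebesgue_outer R n))
    (@caratheodory_measure_ge0 R 'rV[R]_n.+1 (@lebesgue_outer R n))
    (@caratheodory_measure_sigma_additive R 'rV[R]_n.+1 (@lebesgue_outer R n)).

Arguments lebesgue_measure_rV : clear implicits.

Section maximal_function.
Context {R : realType} {n : nat}.
Local Notation V := 'rV[R]_n.+1.
Local Notation T := (lebesgue_space R n).
Implicit Types (A Q P : set V) (QQ : set (set V)) (f : V -> R) (lambda : R).

Local Notation mu := (@lebesgue_measure_rV R n).

Definition nonneg_ae f := {ae mu, forall x, 0 <= f x}.

(* Same shape as [locally_integrable setT], which the library has only on R.  *)
Definition locally_integrable_rV f :=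
  measurable_fun [set: T] (f : T -> R) /\
  forall K : set V, compact K ->
    (\int[mu]_(x in (K : set T)) `|f x|%:E < +oo)%E.

Definition convex_body A :=
  [/\ compact A, convex_set (A : set (convex_lmodType V)) & A° !=set0].

Definition average f A : \bar R :=
  if mu A == 0%E then 0%E
  else ((mu A)^-1 * \int[mu]_(x in (A : set T)) (f x)%:E)%E.

Definition maximal QQ f (x : V) : \bar R :=
  ereal_sup [set average f Q | Q in [set Q | QQ Q /\ Q x]].

Definition exhaustive QQ :=
  forall E : set V, compact E -> exists2 Q, QQ Q & E `<=` Q.

Definition euclidean_dist (x y : V) : R :=
  Num.sqrt (\sum_i (x 0 i - y 0 i) ^+ 2).

Definition diameter A : \bar R :=
  ereal_sup [set (euclidean_dist z.1 z.2)%:E | z in A `*` A].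

(* [F m] is the m-th generation; [ch m P] is the family ch(P) of the sets of
   the generation m + 1 refining [P], seen as a member of [F m].              *)
Record filtration_for QQ lambda f Q
    (F : nat -> set (set V)) (ch : nat -> set V -> set (set V)) : Prop := {
  filtration0 : F 0%N = [set Q] ;
  filtration_countable : forall m, countable (F m) ;
  filtration_sub : forall m, F m `<=` QQ ;
  filtration_cover : forall m, Q = \bigcup_(P in F m) P ;
  filtration_almost_disjoint : forall m P P', (1 <= m)%N ->
    F m P -> F m P' -> P <> P' -> mu (P `&` P') = 0%E ;
  filtration_refine : forall m P, F m P ->
    ch m P `<=` F m.+1 /\ P = \bigcup_(P' in ch m P) P' ;
  filtration_diameter :
    ereal_sup [set diameter P | P in F m] @[m --> \oo] --> 0%E ;
  filtration_average : forall m P, F m P ->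
    (ereal_sup [set average f P' | P' in ch m P] <= lambda%:E * average f P)%E
}.

Definition dense_family lambda QQ :=
  forall f Q, locally_integrable_rV f -> nonneg_ae f -> QQ Q ->
    exists F ch, filtration_for QQ lambda f Q F ch.

End maximal_function.

(* Main.v *)
Require Import Defs.
From mathcomp Require Import all_boot all_order all_algebra.
From mathcomp Require Import all_classical all_reals all_analysis.
From mathcomp Require Import measurable_realfun ring lra.
Set Implicit Arguments.
Unset Strict Implicit.
Unset Printing Implicit Defensive.
Import Order.TTheory GRing.Theory Num.Theory.
Import numFieldNormedType.Exports.
Local Open Scope classical_set_scope.
Local Open Scope ring_scope.

(* Let [C = (lambda^p - 1) / (lambda^p - lambda)].  Fix a body [Q] with its
   filtration and let [N_m (x)] be the largest of the averages of [g] over the sets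
   of the generations [0, ..., m] containing [x].  The function
   [s |-> (C - 1) s^p - C s + 1] is convex and vanishes at [1] and at [lambda]; since
   the averages grow by a factor at most [lambda] from a set to its children, this
   makes [int_Q (N_m^p - C g N_m^(p-1))] nondecreasing in [m], hence at least its
   value [- (C - 1) |Q| <g>_Q^p] at [m = 0].  As the diameters shrink to [0], the
   supremum of the [N_m] is at least [g] almost everywhere, so that
     [C int_Q g^p <= int (M g)^p + (C - 1) |Q| <g>_Q^p].
   For bounded [g] with compact support, the last term tends to [0] along bodies [Q]
   of large measure, which exist by exhaustiveness.  The general case follows by
   monotone convergence along truncations of [f]. *)

(** * Volume of boxes and Lebesgue measurability *)

Lemma integral_cst_indic_itv {R : realType} (r a b : R) : 0 <= r ->
  (\int[lebesgue_measure]_t (r * \1_(`[a, b]%classic : set R) t)%:E =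
   (r * Num.max 0 (b - a))%:E)%E.
Proof.
move=> r0; under eq_integral do rewrite EFinM.
rewrite ge0_integralZl//; last first.
  by apply/measurable_EFinP; exact: measurable_indic.
rewrite integral_indic// setIT EFinM; congr (_ * _)%E.
apply: etrans (lebesgue_measure_itv `[a, b]) _; rewrite /= lte_fin.
case: ltP => ab; first by rewrite (max_idPr _)// subr_ge0 ltW.
by rewrite (max_idPl _)// subr_le0.
Qed.

(* Induction on the dimension, integrating out one coordinate at a time: the
   pointwise inequality between combinations of indicators of boxes yields the
   same inequality between their volumes. *)
Lemma le_volume_of_le_indic {R : realType} (n : nat) :
  forall (c : R) (cs : nat -> R) (a b : nat -> R) (As Bs : nat -> nat -> R),
  0 <= c -> (forall k, 0 <= cs k) ->
  (forall x : nat -> R,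
    (c * \prod_(i < n) \1_(`[a i, b i]%classic : set R) (x i))%:E <=
    \sum_(k <oo)
      (cs k * \prod_(i < n) \1_(`[As k i, Bs k i]%classic : set R) (x i))%:E)%E ->
  ((c * \prod_(i < n) Num.max 0 (b i - a i))%:E <=
   \sum_(k <oo) (cs k * \prod_(i < n) Num.max 0 (Bs k i - As k i))%:E)%E.
Proof.
have prod_ge0 m (u v : nat -> R) : 0 <= \prod_(i < m) Num.max 0 (u i - v i).
  by apply: prodr_ge0 => i _; rewrite le_max lexx.
elim: n => [|n IH] c cs a b As Bs c0 cs0 H.
  have := H (fun=> 0); rewrite !big_ord0; congr (_ <= _)%E.
  by apply: eq_eseriesr => k _; rewrite !big_ord0.
(* With the last coordinate frozen at [t], its indicators are absorbed into the nonnegative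
   coefficients. This is why the statement carries [c] and [cs]: the induction hypothesis then
   applies for each [t]. *)
have Ht t : ((c * \1_(`[a n, b n]%classic : set R) t *
      \prod_(i < n) Num.max 0 (b i - a i))%:E <=
   \sum_(k <oo) (cs k * \1_(`[As k n, Bs k n]%classic : set R) t *
      \prod_(i < n) Num.max 0 (Bs k i - As k i))%:E)%E.
  apply: IH => [|k|x]; rewrite ?mulr_ge0//.
  have := H (fun i => if i == n then t else x i).
  have prodE (u v : nat -> R) (d : R) :
      d * \prod_(i < n.+1) \1_(`[u i, v i]%classic : set R)
            (if i == n :> nat then t else x i) =
      d * \1_(`[u n, v n]%classic : set R) t *
        \prod_(i < n) \1_(`[u i, v i]%classic : set R) (x i).
    rewrite big_ord_recr/= eqxx mulrA mulrAC; congr (_ * _).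
    by apply: eq_bigr => i _; rewrite ltn_eqF.
  rewrite prodE; congr (_ <= _)%E.
  by apply: eq_eseriesr => k _; rewrite prodE.
(* Each last side length is the integral over [t] of an indicator, so the goal is [Ht] integrated in
   [t], with sum and integral exchanged by nonnegativity. *)
rewrite big_ord_recr/= mulrA -integral_cst_indic_itv ?mulr_ge0 ?prod_ge0//.
have -> : (\sum_(k <oo) (cs k * \prod_(i < n.+1) Num.max 0 (Bs k i - As k i))%:E =
   \sum_(k <oo) \int[lebesgue_measure]_t (cs k *
     \prod_(i < n) Num.max 0 (Bs k i - As k i) *
     \1_(`[As k n, Bs k n]%classic : set R) t)%:E)%E.
  apply: eq_eseriesr => k _.
  by rewrite integral_cst_indic_itv ?mulr_ge0 ?prod_ge0// big_ord_recr/= mulrA.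
have mind (r u v : R) : measurable_fun [set: R]
    (fun t => (r * \1_(`[u, v]%classic : set R) t)%:E).
  by apply/measurable_EFinP; apply: measurable_funM => //; exact: measurable_indic.
pose F k t := (cs k * \prod_(i < n) Num.max 0 (Bs k i - As k i) *
  \1_(`[As k n, Bs k n]%classic : set R) t)%:E.
have F0 i t : setT t -> (0 <= F i t)%E by move=> _; rewrite lee_fin !mulr_ge0 ?prod_ge0.
rewrite -(integral_nneseries lebesgue_measure measurableT (fun k => mind _ (As k n) (Bs k n)) F0).
apply: ge0_le_integral => //.
- by move=> t _; rewrite lee_fin !mulr_ge0 ?prod_ge0.
- exact: mind.
- by apply: (@ge0_emeasurable_sum _ _ _ _ F xpredT) => [k x _ _|k _];
    [exact: F0|exact: (mind _ (As k n) (Bs k n))].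
- move=> t _; rewrite mulrAC; apply: le_trans (Ht t) _.
  rewrite le_eqVlt; apply/orP; left; apply/eqP.
  by apply: eq_eseriesr => k _; rewrite mulrAC.
Qed.

Lemma countable_bigcupP {I T : Type} (D : set I) (F : I -> set T) :
  countable D ->
  exists G : nat -> set T,
    [/\ \bigcup_(i in D) F i = \bigcup_k G k,
        forall k, G k = set0 \/ exists2 i, D i & G k = F i &
        trivIset D F -> trivIset setT G].
Proof.
move=> /countable_injP[f finj].
exists (fun k => \bigcup_(i in D `&` f @^-1` [set k]) F i); split.
- apply/seteqP; split=> [x [i Di Fix]|x [k _ [i [Di _] Fix]]]; last by exists i.
  by exists (f i) => //; exists i.
- move=> k; have [[i [Di fi]]|nD] := pselect (exists i, D i /\ f i = k).
    right; exists i => //; apply/seteqP; split => [x [j [Dj fj] Fjx]|x Fix].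
      by have -> : i = j by apply: finj; rewrite ?inE// fi fj.
    by exists i.
  left; apply/seteqP; split => // x [i [Di fi] _]; apply: nD; by exists i.
- move=> tF k l _ _ [x [[i [Di <-] Fix] [j [Dj <-] Fjx]]].
  by congr f; apply: tF => //; exists x.
Qed.

Lemma countable_bigcup_measurable d (T : sigmaRingType d) (I : Type) (D : set I)
    (F : I -> set T) : countable D -> (forall i, D i -> measurable (F i)) ->
  measurable (\bigcup_(i in D) F i).
Proof.
move=> cD mF; have [G [-> GE _]] := countable_bigcupP F cD.
by apply: bigcupT_measurable => k; have [->|[i Di ->]] := GE k; [|exact: mF].
Qed.

Section lebesgue_outer_theory.
Context {R : realType} {n : nat}.
Local Notation V := 'rV[R]_n.+1.
Local Notation T := (lebesgue_space R n).
Local Notation mu := (@lebesgue_measure_rV R n).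
Implicit Types (a b x : V).

Lemma lebesgue_outer_box_le a b : (lebesgue_outer (box a b) <= (box_volume a b)%:E)%E.
Proof.
apply: ereal_inf_lbound => /=.
(* The cover is padded with the degenerate box [(0, 0)], of volume 0. *)
exists (fun k => if k == 0%N then (a, b) else (0, 0)).
  by move=> x abx; exists 0%N.
rewrite (nneseries_split 0 1)//; last first.
  by move=> k _; rewrite lee_fin box_volume_ge0.
rewrite big_nat1 eseries0 ?adde0// => k k1 _; rewrite gtn_eqF//=.
by rewrite /box_volume big_ord_recl /= !mxE subrr maxxx mul0r.
Qed.

(** A cover of the box bounds its indicator pointwise by the sum of the indicators of the covering
    boxes, and [le_volume_of_le_indic] turns this into an inequality of volumes. Coordinates are
    read through [inord], since that lemma indexes them by naturals. *)
Lemma box_volume_le_outer a b : ((box_volume a b)%:E <= lebesgue_outer (box a b))%E.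
Proof.
apply: le_ereal_inf_tmp => _ [B abB <-].
have volE (u v : V) : box_volume u v =
    1 * \prod_(i < n.+1) Num.max 0 (v 0 (inord i) - u 0 (inord i)).
  by rewrite mul1r; apply: eq_bigr => i _; rewrite inord_val.
have -> : (\sum_(k <oo) (box_volume (B k).1 (B k).2)%:E =
    \sum_(k <oo) (1 * \prod_(i < n.+1)
      Num.max 0 ((B k).2 0 (inord i) - (B k).1 0 (inord i)))%:E)%E.
  by apply: eq_eseriesr => k _; rewrite volE.
rewrite volE; apply: (le_volume_of_le_indic (n := n.+1)
  (a := fun i => a 0 (inord i)) (b := fun i => b 0 (inord i))
  (As := fun k i => (B k).1 0 (inord i)) (Bs := fun k i => (B k).2 0 (inord i))
  (cs := fun=> 1)) => // x.
have indE (u v : V) : 1 * \prod_(i < n.+1)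
    (\1_(`[u 0 (inord i), v 0 (inord i)]%classic : set R) (x i) : R) =
    \1_(box u v) (\row_i x i : V).
  rewrite mul1r; have [uvx|uvx] := boolP ((\row_i x i : V) \in box u v).
    rewrite indicE uvx big1// => i _; rewrite indicE inord_val.
    by move: uvx; rewrite inE => /(_ i); rewrite mxE => uvx; rewrite mem_set//= in_itv.
  rewrite indicE (negbTE uvx).
  move: uvx; rewrite notin_setE => /existsNP[i]; rewrite mxE => uvx.
  by rewrite (bigD1 i)//= indicE inord_val memNset ?mul0r//= in_itv/=.
rewrite indE.
under eq_eseriesr do rewrite indE.
have [abx|abx] := boolP ((\row_i x i : V) \in box a b); last first.
  by rewrite indicE (negbTE abx); apply: nneseries_ge0 => k _ _; rewrite lee_fin.
have [k _ Bkx] := abB _ (set_mem abx).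
rewrite indicE abx (@nneseriesD1 _ _ k)//=.
rewrite indicE mem_set// leeDl//.
by apply: nneseries_ge0 => j _ _; rewrite lee_fin.
Qed.

Lemma lebesgue_outer_box a b : lebesgue_outer (box a b) = (box_volume a b)%:E.
Proof. by apply/eqP; rewrite eq_le lebesgue_outer_box_le box_volume_le_outer. Qed.

Definition set_coord a i c : V := \row_j if j == i then c else a 0 j.

(** The [Num.min] and [Num.max] keep additivity true when the hyperplane misses the box: one half is
    then the whole box and the other has volume 0. *)
Lemma box_volume_cut a b i c :
  box_volume a (set_coord b i (Num.min (b 0 i) c)) +
  box_volume (set_coord a i (Num.max (a 0 i) c)) b = box_volume a b.
Proof.
rewrite /box_volume (bigD1 i)//= [X in _ + X](bigD1 i)//= [RHS](bigD1 i)//=.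
rewrite !mxE eqxx.
under eq_bigr => j ji do rewrite mxE (negbTE ji).
under [X in _ + _ * X]eq_bigr => j ji do rewrite mxE (negbTE ji).
rewrite -mulrDl; congr (_ * _).
by rewrite /Num.max /Num.min; do !case: ifPn => //; lra.
Qed.

(** Caratheodory's criterion: cutting every box of a cover of [X] along the hyperplane yields covers
    of the two parts of [X] with the same total volume. *)
Lemma measurable_halfspace i c : measurable ([set x | x 0 i <= c] : set T).
Proof.
apply: le_caratheodory_measurable => X; apply: le_ereal_inf_tmp => _ [B XB <-].
pose B1 k := ((B k).1, set_coord (B k).2 i (Num.min ((B k).2 0 i) c)).
pose B2 k := (set_coord (B k).1 i (Num.max ((B k).1 0 i) c), (B k).2).
have -> : (\sum_(k <oo) (box_volume (B k).1 (B k).2)%:E =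
    \sum_(k <oo) (box_volume (B1 k).1 (B1 k).2)%:E +
    \sum_(k <oo) (box_volume (B2 k).1 (B2 k).2)%:E)%E.
  rewrite -nneseriesD//=; try by move=> k _ _; rewrite lee_fin box_volume_ge0.
  by apply: eq_eseriesr => k _; rewrite -EFinD box_volume_cut.
apply: leeD; apply: ereal_inf_lbound; [exists B1 => //|exists B2 => //].
- move=> x [/XB[k _ kx] xc]; exists k => // j; rewrite mxE; case: eqVneq => [->|_] //.
  by rewrite le_min xc andbT; exact: kx.
- move=> x [/XB[k _ kx] /negP]; rewrite -ltNge => xc; exists k => // j.
  rewrite mxE; case: eqVneq => [->|_] //.
  by rewrite ge_max (ltW xc) andbT; exact: kx.
Qed.

Lemma measurable_coord i : measurable_fun [set: T] (fun x : T => (x : V) 0 i).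
Proof.
apply: (measurability _ (RGenOInfty.measurableE R)) => /= _ [_ [c ->] <-].
rewrite setTI [X in measurable X](_ : _ = ~` [set x : T | (x : V) 0 i <= c]).
  by apply: measurableC; exact: measurable_halfspace.
by apply/seteqP; split => x /=; rewrite in_itv/= andbT ltNge => /negP.
Qed.

Lemma measurable_bigcap_coord (S : 'I_n.+1 -> set R) :
  (forall i, measurable (S i)) ->
  measurable ([set x | forall i, S i (x 0 i)] : set T).
Proof.
move=> mS; rewrite [X in measurable X](_ : _ =
    \bigcap_(i in [set: 'I_n.+1]) ((fun x : T => (x : V) 0 i) @^-1` S i)); last first.
  by apply/seteqP; split => x /= xS i; [move=> _|]; exact: xS.
apply: fin_bigcap_measurable => // i _; rewrite -[X in measurable X]setTI.
exact: measurable_coord.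
Qed.

Lemma measurable_box a b : measurable (box a b : set T).
Proof. exact: (measurable_bigcap_coord (fun i => measurable_itv `[a 0 i, b 0 i])). Qed.

Definition open_box a b : set V := [set x | forall i, a 0 i < x 0 i < b 0 i].

Lemma measurable_open_box a b : measurable (open_box a b : set T).
Proof. exact: (measurable_bigcap_coord (fun i => measurable_itv `]a 0 i, b 0 i[)). Qed.

(** An open set is the union of the countably many boxes with rational corners that it contains. *)
Lemma open_measurable_rV (O : set V) : open O -> measurable (O : set T).
Proof.
move=> oO; pose B (q : 'rV[rat]_n.+1 * 'rV[rat]_n.+1) : set V :=
  box (map_mx ratr q.1) (map_mx ratr q.2).
rewrite (_ : O = \bigcup_(q in [set q | B q `<=` O]) B q); last first.
  apply/seteqP; split => [x Ox|x [q qO]]; last exact: qO.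
  have /nbhs_ballP[e /= e0 eO] : nbhs x O by exact: open_nbhs_nbhs.
  have /choice[q1 q1P] (i : 'I_n.+1) : exists q : rat, (ratr q : R) \in `]x 0 i - e, x 0 i[.
    by apply: rat_in_itvoo; rewrite ltrBlDr ltrDl.
  have /choice[q2 q2P] (i : 'I_n.+1) : exists q : rat, (ratr q : R) \in `]x 0 i, x 0 i + e[.
    by apply: rat_in_itvoo; rewrite ltrDl.
  exists (\row_i q1 i, \row_i q2 i) => /=; last first.
    move=> i; move: (q1P i) (q2P i); rewrite !mxE !in_itv/= => /andP[_ q1x] /andP[xq2 _].
    by rewrite !ltW.
  move=> y yB; apply: eO; split => // j i; rewrite ord1.
  move: (q1P i) (q2P i) (yB i).
  rewrite !mxE !in_itv/= => /andP[q1x _] /andP[_ xq2] /andP[y1 y2].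
  by rewrite /ball/= ltr_distlC (lt_le_trans q1x)// (le_lt_trans y2).
by apply: countable_bigcup_measurable => // q _; exact: measurable_box.
Qed.

Lemma compact_measurable_rV (K : set V) : compact K -> measurable (K : set T).
Proof.
move=> /(compact_closed (@norm_hausdorff _ _)) cK.
rewrite -[K]setCK; apply: measurableC; apply: open_measurable_rV.
exact: closed_openC.
Qed.

Definition cube (r : R) : set V := box (const_mx (- r)) (const_mx r).

Lemma compact_cube r : compact (cube r).
Proof.
have := @rV_compact R n.+1 (fun=> `[- r, r]%classic) (fun=> @segment_compact _ _ _).
by congr compact; apply/seteqP; split => x /= xr i; have := xr i; rewrite ?mxE// in_itv.
Qed.

Lemma lebesgue_cube r : 0 <= r -> mu (cube r) = ((2 * r) ^+ n.+1)%:E.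
Proof.
move=> r0; rewrite /lebesgue_measure_rV lebesgue_outer_box; congr EFin.
rewrite /box_volume (eq_bigr (fun=> 2 * r)).
  by rewrite prodr_const card_ord.
by move=> i _; rewrite !mxE /Num.max; case: ifPn => ?; lra.
Qed.

Lemma compact_sub_cube (K : set V) : compact K -> exists2 r, 0 <= r & K `<=` cube r.
Proof.
move=> /compact_bounded[M [_ MK]]; pose r := Num.max M 0 + 1.
have Mr : M < r by rewrite (@le_lt_trans _ _ (Num.max M 0)) ?le_max ?lexx// ltrDl.
have r0 : 0 <= r by rewrite addr_ge0// le_max lexx orbT.
exists r => // x /(MK _ Mr) xr i; rewrite !mxE -ler_norml (le_trans _ xr)//.
by rewrite [leRHS]/Num.norm/= mx_normrE; apply/bigmax_geP; right; exists (0, i).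
Qed.

Lemma compact_lebesgue_lty (K : set V) : compact K -> (mu K < +oo)%E.
Proof.
move=> cK; have [r r0 Kr] := compact_sub_cube cK.
rewrite (@le_lt_trans _ _ (mu (cube r)))//; last by rewrite lebesgue_cube// ltry.
by apply: le_measure; rewrite ?inE//; [exact: compact_measurable_rV|
  exact: measurable_box].
Qed.

Lemma box_boundary_null a b : mu (box a b `\` open_box a b) = 0%E.
Proof.
pose face i c : set T := box (set_coord a i c) (set_coord b i c).
have face0 i c : mu (face i c) = 0%E.
  rewrite /lebesgue_measure_rV lebesgue_outer_box /box_volume (bigD1 i)//=.
  by rewrite !mxE eqxx subrr maxxx mul0r.
apply: measure_negligible.
  by apply: measurableD; [exact: measurable_box|exact: measurable_open_box].
have nface i c : mu.-negligible (face i c).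
  by apply/negligibleP; [exact: measurable_box|exact: face0].
(* The boundary lies in the faces, which are degenerate boxes. Enumerating the coordinates by
   [inord k] repeats faces but makes the union one over the naturals. *)
apply: (@negligibleS _ _ _ mu
  (\bigcup_k (face (inord k) (a 0 (inord k)) `|` face (inord k) (b 0 (inord k))))).
  move=> x [abx] /existsNP[i /negP]; rewrite negb_and -!leNgt => xi.
  exists i => //=; rewrite inord_val.
  case/orP: xi => xi; [left|right] => j; rewrite !mxE; case: eqVneq => [->|_] //.
    by rewrite xi andbT; have /andP[] := abx i.
  by rewrite xi; have /andP[] := abx i.
by apply: negligible_bigcup => k; exact: negligibleU.
Qed.

Lemma open_box_interior a b x : open_box a b x ->
  exists2 d : R, 0 < d & forall y : V, (forall i, `|x 0 i - y 0 i| < d) -> open_box a b y.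
Proof.
move=> abx; exists (\big[Num.min/1]_i Num.min (x 0 i - a 0 i) (b 0 i - x 0 i)).
  apply: lt_bigmin => // i _; have /andP[? ?] := abx i.
  by rewrite lt_min !subr_gt0; apply/andP.
move=> y xy i; have := xy i; rewrite ltr_distl => /andP[yx xy'].
have : \big[Num.min/1]_i Num.min (x 0 i - a 0 i) (b 0 i - x 0 i) <=
    Num.min (x 0 i - a 0 i) (b 0 i - x 0 i) by exact: bigmin_le.
by rewrite le_min => /andP[? ?]; lra.
Qed.

Lemma coord_le_euclidean_dist x (y : V) i : `|x 0 i - y 0 i| <= euclidean_dist x y.
Proof.
rewrite -sqrtr_sqr ler_sqrt; last by apply: sumr_ge0 => j _; exact: sqr_ge0.
by rewrite (bigD1 i)//= lerDl; apply: sumr_ge0 => j _; exact: sqr_ge0.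
Qed.

(** [O] is the union of the interiors of the boxes of a nearly optimal cover. Passing to interiors
    loses only null boundaries, so [A] is contained in [O] up to a null set. *)
Lemma lebesgue_outer_regular (A : set T) (e : R) : measurable A -> (mu A < +oo)%E -> 0 < e ->
  exists O : set V, [/\ measurable (O : set T),
    (forall x, O x -> exists2 d : R, 0 < d &
      forall y : V, (forall i, `|x 0 i - y 0 i| < d) -> O y),
    mu (A `\` O) = 0%E & (mu O <= mu A + e%:E)%E].
Proof.
move=> mA Aoo e0; have Afin : mu A \is a fin_num by rewrite ge0_fin_numE.
have [_ [B AB <-] Be] := lb_ereal_inf_adherent e0 Afin.
pose O : set T := \bigcup_k open_box (B k).1 (B k).2.
have mO : measurable O by apply: bigcupT_measurable => k; exact: measurable_open_box.
exists O; split => //.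
- move=> x [k _ /open_box_interior[d d0 dB]]; exists d => // y /dB By; by exists k.
- apply: measure_negligible; first exact: measurableD.
  apply: (@negligibleS _ _ _ mu
      (\bigcup_k (box (B k).1 (B k).2 `\` open_box (B k).1 (B k).2))).
    move=> x [/AB[k _ Bx] Ox]; exists k => //; split => // ?; by apply: Ox; exists k.
  apply: negligible_bigcup => k; apply/negligibleP; last exact: box_boundary_null.
  by apply: measurableD; [exact: measurable_box|exact: measurable_open_box].
- apply: le_trans (ltW Be); apply: ereal_inf_lbound; exists B => // x [k _ Bx].
  by exists k => // i; have /andP[? ?] := Bx i; rewrite !ltW.
Qed.

End lebesgue_outer_theory.

(** * The sharp constant *)

Section sharp_constant.
Context {R : realType}.
Implicit Types (p lambda a v s : R).

Definition sharp_constant p lambda : R :=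
  (lambda `^ p - 1) / (lambda `^ p - lambda).

(** This makes the denominator of the sharp constant positive; it amounts to [lambda^(p-1) > 1]. *)
Lemma powR_gt_self p lambda : 1 < p -> 1 < lambda -> lambda < lambda `^ p.
Proof.
move=> p1 l1; have l0 : 0 < lambda by rewrite (lt_trans ltr01).
rewrite -mulr_powRB1 ?(ltW l0) ?(lt_trans ltr01)// ltr_pMr//.
rewrite -[ltLHS](@powRr0 _ lambda) /powR gt_eqF// ltr_expR ltr_pM2r ?subr_gt0//.
exact: ln_gt0.
Qed.

Lemma sharp_constant_ge1 p lambda : 1 < p -> 1 < lambda -> 1 <= sharp_constant p lambda.
Proof.
move=> p1 l1; have lp := powR_gt_self p1 l1.
by rewrite ler_pdivlMr ?subr_gt0// mul1r; lra.
Qed.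

(* The convex function [s |-> (C - 1) s^p - C s + 1] vanishes at [1] and, by the
   choice of [C], at [lambda]. *)
Lemma sharp_constant_chord p lambda s : 1 < p -> 1 < lambda -> 1 <= s <= lambda ->
  (sharp_constant p lambda - 1) * s `^ p + 1 <= sharp_constant p lambda * s.
Proof.
move=> p1 l1 /andP[s1 sl]; set C := sharp_constant _ _; have lp := powR_gt_self p1 l1.
have C1 : 1 <= C by exact: sharp_constant_ge1.
have CE : C * (lambda `^ p - lambda) = lambda `^ p - 1.
  by rewrite divfK// gt_eqF// subr_gt0.
(* The weight for which [s = t * 1 + (1 - t) * lambda], so that convexity of the power bounds [s^p]
   by its chord. *)
pose t := (lambda - s) / (lambda - 1).
have t01 : 0 <= t <= 1.
  rewrite divr_ge0 ?subr_ge0//=; last exact: ltW.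
  by rewrite ler_pdivrMr ?subr_gt0// mul1r; lra.
have tE : t * (lambda - 1) = lambda - s by rewrite divfK// gt_eqF// subr_gt0.
have sE : s = t + (1 - t) * lambda by lra.
have sp : s `^ p <= t + (1 - t) * lambda `^ p.
  have /andP[t0 t1] := t01.
  have := convex_powR (ltW p1) (Itv01 t0 t1) (x := 1) (y := lambda).
  rewrite !inE/= !in_itv/= !andbT ler01 => /(_ isT).
  rewrite (ltW (lt_trans ltr01 l1)) => /(_ isT).
  by rewrite convRE/= powR1 !mulr1 -[X in X `^ p]/(t * 1 + (1 - t) * lambda) mulr1 -sE.
have : (C - 1) * s `^ p <= (C - 1) * (t + (1 - t) * lambda `^ p).
  by apply: ler_wpM2l => //; rewrite subr_ge0.
move=> /le_trans H; rewrite -lerBrDr; apply: H.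
have -> : (C - 1) * (t + (1 - t) * lambda `^ p) =
  t * (C - 1) + (1 - t) * (C * (lambda `^ p - lambda) - lambda `^ p + C * lambda) by ring.
by rewrite CE sE; lra.
Qed.

(** The chord inequality at [s = v / a], multiplied by [a^p]. Here [a] stands for the old running
    maximum and [v] for a larger new average; if [a = 0] then [v = 0] as well. *)
Lemma sharp_constant_step p lambda a v : 1 < p -> 1 < lambda ->
  0 <= a -> a <= v <= lambda * a ->
  a `^ p + sharp_constant p lambda * v `^ p <=
  v `^ p + sharp_constant p lambda * (v * a `^ (p - 1)).
Proof.
move=> p1 l1; rewrite le_eqVlt => /orP[/eqP <-|a0] avl.
  have -> : v = 0 by apply/eqP; rewrite eq_le; move: avl; rewrite mulr0 andbC.
  by rewrite powR0 ?gt_eqF ?(lt_trans ltr01)// !mulr0 mul0r mulr0.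
have ap : 0 < a `^ p by exact: powR_gt0.
have vE : v = v / a * a by rewrite divfK// gt_eqF.
have v0 : 0 <= v / a by rewrite divr_ge0 ?(ltW a0)// (le_trans (ltW a0))//; case/andP: avl.
have := @sharp_constant_chord p lambda (v / a) p1 l1.
rewrite ler_pdivlMr// mul1r ler_pdivrMr// => /(_ avl) /=.
rewrite -(ler_pM2l ap) => H.
have -> : v `^ p = (v / a) `^ p * a `^ p by rewrite -powRM ?(ltW a0)// -vE.
have -> : v * a `^ (p - 1) = v / a * a `^ p.
  by rewrite -[in RHS]mulr_powRB1 ?(ltW a0) ?(lt_trans ltr01)// mulrA -vE.
move: H; set C := sharp_constant _ _; lra.
Qed.

End sharp_constant.

(** * Monotonicity of integrals and comparison piece by piece *)

Section integral_comparison.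
Context d (T : measurableType d) (R : realType) (mu : {measure set T -> \bar R}).

(** The integral of a nonnegative function is a supremum over the simple functions below it, hence
    monotone for arbitrary functions. In this form it applies to powers of the maximal function. *)
Lemma le_integral_lower (D : set T) (f g : T -> \bar R) :
  (forall x, D x -> (0 <= f x)%E) -> (forall x, D x -> (f x <= g x)%E) ->
  (\int[mu]_(x in D) f x <= \int[mu]_(x in D) g x)%E.
Proof.
move=> f0 fg; have g0 x : D x -> (0 <= g x)%E.
  by move=> Dx; rewrite (le_trans (f0 _ Dx))// fg.
rewrite !ge0_integralE//; apply: ereal_sup_le => _ [h /= hf <-]; exists h => //= x.
apply: le_trans (hf x) _; rewrite !patchE; case: ifPn => // xD.
by rewrite fg//; exact: set_mem.
Qed.

Lemma le_integral_lower_subset (A B : set T) (f g : T -> \bar R) : A `<=` B ->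
  (forall x, A x -> (0 <= f x)%E) -> (forall x, A x -> (f x <= g x)%E) ->
  (forall x, B x -> (0 <= g x)%E) ->
  (\int[mu]_(x in A) f x <= \int[mu]_(x in B) g x)%E.
Proof.
move=> AB f0 fg gB; rewrite (integral_mkcond A) (integral_mkcond B).
apply: le_integral_lower => x _; rewrite !patchE.
  by case: ifPn => // xA; exact/f0/set_mem.
case: ifPn => [/set_mem xA|_]; first by rewrite mem_set ?fg//; exact: AB.
by case: ifPn => // /set_mem; exact: gB.
Qed.

Lemma le_integral_pieces I (D : set I) (F : I -> set T) (h1 h2 : T -> \bar R) :
  countable D -> (forall i, D i -> measurable (F i)) -> trivIset D F ->
  let U := \bigcup_(i in D) F i in
  measurable_fun U h1 -> measurable_fun U h2 ->
  (forall x, U x -> (0 <= h1 x)%E) -> (forall x, U x -> (0 <= h2 x)%E) ->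
  (forall i, D i -> \int[mu]_(x in F i) h1 x <= \int[mu]_(x in F i) h2 x)%E ->
  (\int[mu]_(x in U) h1 x <= \int[mu]_(x in U) h2 x)%E.
Proof.
move=> cD mF tF; have [G [-> GE tG]] := countable_bigcupP F cD.
move=> U mh1 mh2 h10 h20 h12.
have mG k : measurable (G k) by have [->|[i Di ->]] := GE k => //; exact: mF.
rewrite !ge0_integral_bigcup//; try exact: tG.
apply: lee_nneseries => k _ *.
  by apply: integral_ge0 => x Gkx; apply: h10; exists k.
by have [->|[i Di ->]] := GE k; [rewrite !integral_set0|exact: h12].
Qed.

End integral_comparison.

(** * Maximal averages along a filtration *)

Lemma countable_bigcup_negligible d (T : sigmaRingType d) (R : realFieldType)
    (mu : {measure set T -> \bar R}) (I : Type) (D : set I) (F : I -> set T) :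
  countable D -> (forall i, D i -> mu.-negligible (F i)) ->
  mu.-negligible (\bigcup_(i in D) F i).
Proof.
move=> cD nF; have [G [-> GE _]] := countable_bigcupP F cD.
apply: negligible_bigcup => k; have [->|[i Di ->]] := GE k; last exact: nF.
exact: negligible_set0.
Qed.

Section filtration.
Context {R : realType} {n : nat}.
Local Notation V := 'rV[R]_n.+1.
Local Notation T := (lebesgue_space R n).
Local Notation mu := (@lebesgue_measure_rV R n).
Context (QQ : set (set V)) (p lambda M : R) (g : V -> R) (Q : set V).
Context (F : nat -> set (set V)) (ch : nat -> set V -> set (set V)).
Context (p1 : 1 < p) (l1 : 1 < lambda).
Context (compactQQ : QQ `<=` [set K | compact K]).
Context (mg : measurable_fun [set: T] (g : T -> R)).
Context (g0 : forall x, 0 <= g x) (gM : forall x, g x <= M).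
Context (HF : filtration_for QQ lambda g Q F ch).

Local Notation C := (sharp_constant p lambda).

Let M0 : 0 <= M. Proof. exact: le_trans (g0 0) (gM 0). Qed.

Let p0 : 0 < p. Proof. exact: lt_trans ltr01 p1. Qed.

Let p10 : 0 <= p - 1. Proof. by rewrite subr_ge0 ltW. Qed.

Let C0 : 0 <= C. Proof. exact: le_trans ler01 (sharp_constant_ge1 p1 l1). Qed.

Lemma measurable_generation m P : F m P -> measurable (P : set T).
Proof. by move=> /(filtration_sub HF)/compactQQ; exact: compact_measurable_rV. Qed.

Lemma generation_lty m P : F m P -> (mu P < +oo)%E.
Proof. by move=> /(filtration_sub HF)/compactQQ; exact: compact_lebesgue_lty. Qed.

Let mgE (D : set T) : measurable_fun D (EFin \o g).
Proof. by apply/measurable_EFinP; exact: measurable_funTS. Qed.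

Definition real_average (P : set V) : R := fine (average g P).

Lemma integral_generation_le m P : F m P ->
  (\int[mu]_(x in (P : set T)) (g x)%:E <= M%:E * mu P)%E.
Proof.
move=> FP; have mP := measurable_generation FP.
rewrite -integral_cst//; by apply: ge0_le_integral => // x _; rewrite lee_fin.
Qed.

(** The average is a real number, and integral equals average times measure even when [P] is null:
    the average is then 0 by convention and the integral vanishes. *)
Lemma average_integral m P : F m P -> exists a : R,
  [/\ 0 <= a <= M, average g P = a%:E &
      (\int[mu]_(x in (P : set T)) (g x)%:E = a%:E * mu P)%E].
Proof.
move=> FP; have mP := measurable_generation FP.
have := integral_generation_le FP.
have : (0 <= \int[mu]_(x in (P : set T)) (g x)%:E)%E.
  by apply: integral_ge0 => x _; rewrite lee_fin.
rewrite /average; have [P0 _ _|P0] := eqVneq (mu P) 0%E.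
  exists 0; rewrite lexx M0 mul0e; split => //.
  by apply: null_set_integral => //; exact: mgE.
have : (0 <= mu P)%E by exact: measure_ge0.
have := generation_lty FP.
case: (mu P) P0 => [r|//|//]; rewrite eqe => r0 _; rewrite lee_fin => r_ge0.
have r_gt0 : 0 < r by rewrite lt_def r0.
case: (integral _ _ _) => [i|//|//]; rewrite -EFinM !lee_fin => i0 iM.
exists (r^-1 * i); rewrite inver (negbTE r0) -!EFinM; split => //.
  by rewrite mulr_ge0 ?invr_ge0//= mulrC ler_pdivrMr.
by rewrite mulrAC mulVf// mul1r.
Qed.

Lemma average_generation m P : F m P -> average g P = (real_average P)%:E.
Proof. by case/average_integral => a [_ aE _]; rewrite /real_average aE. Qed.

Lemma real_average_itv m P : F m P -> 0 <= real_average P <= M.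
Proof. by case/average_integral => a [aM aE _]; rewrite /real_average aE. Qed.

Lemma integral_average m P : F m P ->
  (\int[mu]_(x in (P : set T)) (g x)%:E = (real_average P)%:E * mu P)%E.
Proof. by case/average_integral => a [_ aE ->]; rewrite /real_average aE. Qed.

(** * Cells and running maxima off the null overlaps *)

Definition overlap : set T :=
  \bigcup_(m in [set: nat]) \bigcup_(PP in [set PP | [/\ (1 <= m)%N, F m PP.1, F m PP.2 &
    PP.1 <> PP.2]]) (PP.1 `&` PP.2).

Let countable_pairs m : countable [set PP | [/\ (1 <= m)%N, F m PP.1, F m PP.2 &
    PP.1 <> PP.2]].
Proof.
have := filtration_countable HF m => cF.
by apply: sub_countable (countableX cF cF); apply: subset_card_le => -[P P'] [].
Qed.

Lemma measurable_overlap : measurable overlap.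
Proof.
apply: bigcupT_measurable => m; apply: countable_bigcup_measurable => // -[P P'] [_ FP FP' _].
by apply: measurableI; [exact: measurable_generation FP|exact: measurable_generation FP'].
Qed.

Lemma overlap_null : mu overlap = 0%E.
Proof.
apply: measure_negligible; first exact: measurable_overlap.
apply: negligible_bigcup => m.
apply: countable_bigcup_negligible => // -[P P'] [/= m1 FP FP' PP'].
apply/negligibleP; last exact: (filtration_almost_disjoint HF m1 FP FP' PP').
by apply: measurableI; [exact: measurable_generation FP|exact: measurable_generation FP'].
Qed.

(** The part of [Q], of full measure, whose points lie in exactly one set of each generation.
    Generation 0 is the singleton of [Q], so overlaps arise only from generation 1 on. *)
Definition core : set T := Q `\` overlap.

Lemma measurable_core : measurable core.
Proof.
apply: measurableD; last exact: measurable_overlap.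
by apply: (@measurable_generation 0); rewrite (filtration0 HF).
Qed.

(** The default [set0] does not occur on [core], where the cell exists and is unique. *)
Definition cell m (x : V) : set V := xget set0 [set P | F m P /\ P x].

Lemma core_unique m P P' x : core x -> F m P -> F m P' -> P x -> P' x -> P = P'.
Proof.
move=> [Qx ox]; case: m => [|m].
  by rewrite (filtration0 HF) => -> ->.
move=> FP FP' Px P'x; apply: contra_notP ox => PP'.
by exists m.+1 => //; exists (P, P').
Qed.

Lemma cellE m P x : core x -> F m P -> P x -> cell m x = P.
Proof.
move=> cx FP Px; apply: xget_subset1; first by split.
by move=> A B [FA Ax] [FB Bx]; exact: core_unique cx FA FB Ax Bx.
Qed.

Lemma cell_generation m x : core x -> F m (cell m x) /\ cell m x x.
Proof.
move=> [Qx _]; apply: (xgetPex set0 (P := [set P | F m P /\ P x])).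
by move: Qx; rewrite (filtration_cover HF m) => -[P FP Px]; exists P.
Qed.

Lemma cell_child m x : core x -> ch m (cell m x) (cell m.+1 x).
Proof.
move=> cx; have [FP Px] := cell_generation m cx.
have [chF PE] := filtration_refine HF FP.
move: Px; rewrite {1}PE => -[P' chP' P'x].
by rewrite (cellE cx (chF _ chP') P'x).
Qed.

(** The cell of [x] in generation [m] contains the shared cell as a child, hence contains [y]. So
    points sharing a cell share all its ancestors, which makes [max_average m] constant on cells. *)
Lemma cell_parent m x y : core x -> core y -> cell m.+1 x = cell m.+1 y ->
  cell m x = cell m y.
Proof.
move=> cx cy xy; have [FP Px] := cell_generation m cx.
have [_ PE] := filtration_refine HF FP.
apply/esym/(cellE cy FP); rewrite PE; exists (cell m.+1 x); first exact: cell_child.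
by rewrite xy; exact: (cell_generation m.+1 cy).2.
Qed.

Definition cell_average m x : R := real_average (cell m x).

Fixpoint max_average m x : R :=
  if m is m'.+1 then Num.max (max_average m' x) (cell_average m x)
  else cell_average 0 x.

Lemma max_average_cell m x y : core x -> core y -> cell m x = cell m y ->
  max_average m x = max_average m y.
Proof.
move=> cx cy; elim: m => [|m IH] xy /=; first by rewrite /cell_average xy.
by rewrite (IH (cell_parent cx cy xy)) /cell_average xy.
Qed.

Lemma cell_average_child m x : core x ->
  cell_average m.+1 x <= lambda * cell_average m x.
Proof.
move=> cx; have [FP Px] := cell_generation m cx.
have [FP' _] := cell_generation m.+1 cx.
rewrite -lee_fin EFinM -(average_generation FP) -(average_generation FP').
apply: le_trans (filtration_average HF FP).
by apply: ereal_sup_ubound; exists (cell m.+1 x) => //; exact: cell_child.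
Qed.

Lemma max_average_itv m x : core x -> 0 <= max_average m x <= M.
Proof.
move=> cx; have cM k : 0 <= cell_average k x <= M.
  by apply: (@real_average_itv k); exact: (cell_generation k cx).1.
elim: m => [|m /andP[IH1 IH2]] /=; first exact: cM.
have /andP[_ cMm] := cM m.+1.
by rewrite le_max IH1/= ge_max IH2.
Qed.

Lemma cell_average_le_max m k x : (k <= m)%N -> cell_average k x <= max_average m x.
Proof.
elim: m => [|m IH]; first by rewrite leqn0 => /eqP ->.
rewrite leq_eqVlt => /predU1P[->|km] /=; first by rewrite le_max lexx orbT.
by rewrite le_max IH.
Qed.

Lemma max_average_nd x : {homo max_average^~ x : k m / (k <= m)%N >-> k <= m}.
Proof. by apply: homo_leq => // [? ? ?|k]; [exact: le_trans|rewrite /= le_max lexx]. Qed.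

Lemma max_average_le_maximal m x : core x -> ((max_average m x)%:E <= maximal QQ g x)%E.
Proof.
move=> cx; have cQ k : ((cell_average k x)%:E <= maximal QQ g x)%E.
  have [FP Px] := cell_generation k cx.
  rewrite -(average_generation FP); apply: ereal_sup_ubound; exists (cell k x) => //.
  by split => //; exact: (filtration_sub HF FP).
elim: m => [|m IH]; first exact: cQ.
by rewrite /= EFin_max ge_max IH cQ.
Qed.

Lemma measurable_cell_average m : measurable_fun core (cell_average m).
Proof.
move=> mcore Y mY.
rewrite (_ : core `&` cell_average m @^-1` Y =
  \bigcup_(P in F m `&` real_average @^-1` Y) (P `&` core)).
  apply: countable_bigcup_measurable.
    by apply: sub_countable (filtration_countable HF m); exact: subset_card_le (@subIsetl _ _ _).
  by move=> P [FP _]; apply: measurableI => //; exact: measurable_generation FP.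
apply/seteqP; split => [x [cx Yx]|x [P [FP YP] [Px cx]]].
  have [FP Px] := cell_generation m cx.
  by exists (cell m x).
by split => //; rewrite /= /cell_average (cellE cx FP Px).
Qed.

Lemma measurable_max_average m : measurable_fun core (max_average m).
Proof.
elim: m => [|m IH] /=; first exact: measurable_cell_average.
by apply: measurable_maxr => //; exact: measurable_cell_average.
Qed.

Lemma core_cover m : core = \bigcup_(P in F m) (P `&` core).
Proof.
apply/seteqP; split => [x cx|x [P _ []//]].
by have [FP Px] := cell_generation m cx; exists (cell m x).
Qed.

Lemma trivIset_core m : trivIset (F m) (fun P => P `&` core).
Proof. by move=> P P' FP FP' [x [[Px cx] [P'x _]]]; exact: core_unique cx FP FP' Px P'x. Qed.

Lemma generation_sub m P : F m P -> P `<=` Q.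
Proof. by move=> FP x Px; rewrite (filtration_cover HF m); exists P. Qed.

Lemma generation_core m P : F m P -> P `&` core = P `\` overlap.
Proof.
move=> FP; rewrite /core setDE setIA (_ : P `&` Q = P) ?setDE//.
exact/setIidPl/(generation_sub FP).
Qed.

(** On a cell the running maxima are constant, so the integrands that occur are affine in [g] and
    their integrals depend only on the average of [g]. *)
Lemma integral_affine_core m P (a b : R) : F m P -> 0 <= a -> 0 <= b ->
  (\int[mu]_(x in (P `&` core : set T)) (a + b * g x)%:E =
   (a + b * real_average P)%:E * mu P)%E.
Proof.
move=> FP a0 b0; have mP := measurable_generation FP.
have mh : measurable_fun (P : set T) (fun x => (a + b * g x)%:E).
  apply/measurable_EFinP; have mgP : measurable_fun (P : set T) (g : T -> R).
    exact: measurable_funTS.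
  exact: (measurable_funD (measurable_cst a) (measurable_funM (measurable_cst b) mgP)).
rewrite (generation_core FP) -ge0_negligible_integral//; last 3 first.
- exact: measurable_overlap.
- by move=> x _; rewrite lee_fin addr_ge0// mulr_ge0.
- exact: overlap_null.
under eq_integral do rewrite EFinD EFinM.
have mbg : measurable_fun (P : set T) (fun x => b%:E * (g x)%:E)%E.
  by apply: emeasurable_funM => //; exact: mgE.
have bg0 x : P x -> (0 <= b%:E * (g x)%:E)%E by rewrite mule_ge0// lee_fin.
rewrite ge0_integralD// ge0_integralZl_EFin//; last by move=> x _; rewrite lee_fin.
rewrite (integral_average FP) integral_cst//.
have /andP[v0 _] := real_average_itv FP.
by rewrite EFinD EFinM ge0_muleDl ?lee_fin ?mulr_ge0// muleA.
Qed.

(** * Monotonicity in the generation *)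

Let mpow m q : measurable_fun core (fun x => max_average m x `^ q).
Proof.
exact: (measurableT_comp (measurable_powR q) (measurable_max_average m)).
Qed.

Let mcore : measurable core. Proof. exact: measurable_core. Qed.

(** Proved on each cell of generation [m + 1], where both sides are constants times its measure. The
    negative terms of the functional are moved across, so that no extended reals are subtracted. *)
Lemma integral_max_average_step m :
  (\int[mu]_(x in core) (max_average m x `^ p +
     C * (g x * max_average m.+1 x `^ (p - 1)))%:E <=
   \int[mu]_(x in core) (max_average m.+1 x `^ p +
     C * (g x * max_average m x `^ (p - 1)))%:E)%E.
Proof.
have mh k l : measurable_fun core (fun x => (max_average k x `^ p +
    C * (g x * max_average l x `^ (p - 1)))%:E).
  apply/measurable_EFinP; have mgc : measurable_fun core (g : T -> R).
    exact: measurable_funTS.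
  exact: (measurable_funD (mpow k p) (measurable_funM (measurable_cst C)
    (measurable_funM mgc (mpow l (p - 1))))).
have h0 k l x : (0 <= (max_average k x `^ p +
    C * (g x * max_average l x `^ (p - 1)))%:E)%E.
  by rewrite lee_fin (addr_ge0 (powR_ge0 _ _))// (mulr_ge0 C0)// (mulr_ge0 (g0 _))// powR_ge0.
rewrite (core_cover m.+1); apply: le_integral_pieces.
- exact: filtration_countable HF _.
- by move=> P FP; apply: measurableI => //; exact: measurable_generation FP.
- exact: trivIset_core.
- by rewrite -core_cover.
- by rewrite -core_cover.
- by [].
- by [].
move=> P FP.
have [[y [Py cy]]|P0] := pselect ((P `&` core) !=set0); last first.
  have -> : P `&` core = set0 by apply/seteqP; split => // x Px; apply: P0; exists x.
  by rewrite !integral_set0.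
pose a := max_average m y; pose v := real_average P.
have NmE x : (P `&` core) x -> max_average m x = a.
  move=> [Px cx]; apply: max_average_cell => //; apply: cell_parent => //.
  by rewrite (cellE cx FP Px) (cellE cy FP Py).
have NSE x : (P `&` core) x -> max_average m.+1 x = Num.max a v.
  by move=> [Px cx]; rewrite /= NmE// /cell_average (cellE cx FP Px).
have a0 : 0 <= a by have /andP[] := max_average_itv m cy.
(* The new average is at most [lambda] times that of the parent cell, which the old maximum [a]
   dominates. *)
have va : v <= lambda * a.
  rewrite /v -(cellE cy FP Py) (le_trans (cell_average_child m cy))//.
  by rewrite ler_wpM2l ?(ltW (lt_trans ltr01 l1))// cell_average_le_max.
have hE (s t : R) : 0 <= s -> 0 <= t ->
   (\int[mu]_(x in (P `&` core : set T)) (s `^ p + C * (g x * t `^ (p - 1)))%:E =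
   (s `^ p + C * (v * t `^ (p - 1)))%:E * mu P)%E.
  move=> s0 t0; rewrite (eq_integral (fun x : T => (s `^ p + C * t `^ (p - 1) * g x)%:E)).
    rewrite (integral_affine_core FP (powR_ge0 _ _) (mulr_ge0 C0 (powR_ge0 _ _))).
    by rewrite -mulrA [t `^ _ * _]mulrC.
  by move=> x _; rewrite -mulrA [t `^ _ * _]mulrC.
rewrite (eq_integral (fun x : T => (a `^ p + C * (g x * Num.max a v `^ (p - 1)))%:E)); last first.
  by move=> x; rewrite inE => Px; rewrite NmE// NSE.
rewrite [leRHS](eq_integral (fun x : T => (Num.max a v `^ p + C * (g x * a `^ (p - 1)))%:E)); last first.
  by move=> x; rewrite inE => Px; rewrite NmE// NSE.
rewrite !hE ?le_max ?a0//.
apply: lee_wpmul2r; first exact: measure_ge0.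
(* If [v <= a] the maximum does not change and the two sides coincide; otherwise it becomes [v]. *)
rewrite lee_fin; case: (leP v a) => [//|av].
rewrite mulr_powRB1//; last exact: le_trans (ltW av).
by apply: sharp_constant_step => //; rewrite (ltW av).
Qed.

(** The running maximum is at most [M] on a set of finite measure. Finiteness permits cancelling
    this integral in the induction on [m]. *)
Lemma integral_max_average_pow_fin m :
  (\int[mu]_(x in core) (max_average m x `^ p)%:E)%E \is a fin_num.
Proof.
have mQ : measurable (Q : set T).
  by apply: (@measurable_generation 0); rewrite (filtration0 HF).
have coreQ : (mu core <= mu Q)%E by apply: le_measure; rewrite ?inE// => x [].
have Qoo : (mu Q < +oo)%E by apply: (@generation_lty 0); rewrite (filtration0 HF).
rewrite ge0_fin_numE; last by apply: integral_ge0 => x _; rewrite lee_fin powR_ge0.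
apply: (@le_lt_trans _ _ ((M `^ p)%:E * mu core)%E).
  rewrite -(integral_cst mu mcore (M `^ p)%:E); apply: le_integral_lower => x cx.
    by rewrite lee_fin powR_ge0.
  have /andP[Nx0 NxM] := max_average_itv m cx.
  by rewrite lee_fin ge0_ler_powR// ?nnegrE// ltW.
by rewrite lte_mul_pinfty ?lee_fin ?powR_ge0// (le_lt_trans coreQ).
Qed.

(* With the sharp constant [C], the functional [int (N_m^p - C g N_m^(p-1))] is
   nondecreasing in [m], for [N_m] the running maximum [max_average m]; its value
   at [m = 0] is [(1 - C) |Q| <g>_Q^p]. *)
Lemma integral_max_average_ge m :
  (C%:E * \int[mu]_(x in core) (g x * max_average m x `^ (p - 1))%:E <=
   \int[mu]_(x in core) (max_average m x `^ p)%:E +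
   ((C - 1) * real_average Q `^ p)%:E * mu Q)%E.
Proof.
have FQ : F 0%N Q by rewrite (filtration0 HF).
have mgc : measurable_fun core (g : T -> R) by exact: measurable_funTS.
have mgN k : measurable_fun core (fun x => (g x * max_average k x `^ (p - 1))%:E).
  by apply/measurable_EFinP; exact: (measurable_funM mgc (mpow k (p - 1))).
have gN0 k (x : T) : core x -> (0 <= (g x * max_average k x `^ (p - 1))%:E)%E.
  by rewrite lee_fin (mulr_ge0 (g0 _))// powR_ge0.
have mN k : measurable_fun core (fun x => (max_average k x `^ p)%:E).
  by apply/measurable_EFinP; exact: mpow.
have N0 k (x : T) : core x -> (0 <= (max_average k x `^ p)%:E)%E.
  by rewrite lee_fin powR_ge0.
have split k l : (\int[mu]_(x in core) (max_average k x `^ p +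
    C * (g x * max_average l x `^ (p - 1)))%:E =
    \int[mu]_(x in core) (max_average k x `^ p)%:E +
    C%:E * \int[mu]_(x in core) (g x * max_average l x `^ (p - 1))%:E)%E.
  under eq_integral do rewrite EFinD EFinM.
  have mCgN : measurable_fun core
      (fun x => C%:E * (g x * max_average l x `^ (p - 1))%:E)%E.
    exact: (emeasurable_funM (measurable_cst _) (mgN l)).
  have CgN0 (x : T) : core x -> (0 <= C%:E * (g x * max_average l x `^ (p - 1))%:E)%E.
    by move=> cx; apply: mule_ge0; [rewrite lee_fin|exact: gN0].
  rewrite (ge0_integralD mu mcore (N0 k) (mN k) CgN0 mCgN).
  by rewrite (ge0_integralZl_EFin mu mcore (gN0 l) (mgN l) C0).
elim: m => [|m IH].
  (* At [m = 0] the running maximum is the average over [Q], and the inequality is an equality. *)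
  have NQ x : core x -> max_average 0 x = real_average Q.
    by move=> cx; rewrite /= /cell_average (cellE cx FQ)//; case: cx.
  have /andP[v0 _] := real_average_itv FQ.
  have cQ : core = Q `&` core by apply/seteqP; split => [x []|x []].
  rewrite (eq_integral (fun x : T => (0 + real_average Q `^ (p - 1) * g x)%:E)); last first.
    by move=> x; rewrite inE => cx; rewrite NQ// add0r mulrC.
  rewrite [in leRHS](eq_integral (fun x : T => (real_average Q `^ p + 0 * g x)%:E)); last first.
    by move=> x; rewrite inE => cx; rewrite NQ// mul0r addr0.
  rewrite cQ (integral_affine_core FQ (lexx 0) (powR_ge0 _ _)).
  rewrite (integral_affine_core FQ (powR_ge0 _ _) (lexx 0)) add0r mul0r addr0.
  rewrite [_ `^ _ * _]mulrC mulr_powRB1// muleA -ge0_muleDl ?lee_fin ?powR_ge0//; last first.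
    by rewrite mulr_ge0 ?powR_ge0// subr_ge0 sharp_constant_ge1.
  by rewrite -EFinM -EFinD mulrBl mul1r addrCA subrr addr0.
(* Add the finite integral of [N_m^p] to both sides, apply the one-step inequality, then the
   induction hypothesis. *)
have := integral_max_average_step m; rewrite !split => H.
rewrite -(@leeD2lE _ _ _ _ (integral_max_average_pow_fin m)).
by apply: (le_trans H); rewrite addeCA; apply: leeD.
Qed.

(** * Recovering [g] from the averages on shrinking cells *)

Lemma cell_shrinks x d : 0 < d -> core x ->
  exists j, forall m, (j <= m)%N -> forall y i, cell m x y -> `|x 0 i - y 0 i| < d.
Proof.
move=> d0 cx.
have nd : nbhs (0%E : \bar R) [set y | (y < d%:E)%E].
  by apply: open_nbhs_nbhs; split; [exact: open_ereal_lt_ereal|rewrite /= lte_fin].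
have [j _ jd] := filtration_diameter HF nd.
exists j => m /jd md y i ymx; have [FP Px] := cell_generation m cx.
rewrite (le_lt_trans (coord_le_euclidean_dist _ _ _))// -lte_fin (le_lt_trans _ md)//.
apply: (@le_trans _ _ (diameter (cell m x))).
  by apply: ereal_sup_ubound; exists (x, y).
by apply: ereal_sup_ubound; exists (cell m x).
Qed.

(** For rational [a < b] these sets cover the points of [core] where the supremum of the running
    maxima falls short of [g]. *)
Definition stalled (a b : R) : set T :=
  [set x | [/\ core x, b < g x & forall m, max_average m x <= a]].

Lemma measurable_stalled a b : measurable (stalled a b).
Proof.
rewrite (_ : stalled a b = (core `&` g @^-1` `]b, +oo[) `&`
  \bigcap_m (core `&` max_average m @^-1` `]-oo, a])); last first.
  apply/seteqP; split => [x [cx bx xa]|x [[cx bx] xa]].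
    split; first by split => //; rewrite /= in_itv/= bx.
    by move=> m _; split => //; rewrite /= in_itv/= xa.
  split => //; first by move: bx; rewrite /= in_itv/= andbT.
  by move=> m; have [_] := xa m I; rewrite /= in_itv.
apply: measurableI.
  by apply: (measurable_funTS mg) => //; exact: measurable_itv.
apply: bigcapT_measurable => m; apply: measurable_max_average => //.
Qed.

(* If the averages along the filtration stay below [a] on a set [A] where [g > b],
   then the cells meeting [A] inside an almost optimal open cover [E] of [A] form a
   set [U] with [b |A| <= int_U g <= a |U| <= a (|A| + e)] in the limit. *)
Lemma stalled_null a b : 0 <= a -> a < b -> mu (stalled a b) = 0%E.
Proof.
move=> a0 ab; set A := stalled a b; have mA : measurable A by exact: measurable_stalled.
have mQ : measurable (Q : set T).
  by apply: (@measurable_generation 0); rewrite (filtration0 HF).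
have Qoo : (mu Q < +oo)%E by apply: (@generation_lty 0); rewrite (filtration0 HF).
have Aoo : (mu A < +oo)%E.
  by rewrite (le_lt_trans _ Qoo)//; apply: le_measure; rewrite ?inE// => x [[]].
have key e : 0 < e -> (b%:E * mu A <= a%:E * (mu A + e%:E))%E.
  move=> e0; have [E [mO openO AO Oe]] := lebesgue_outer_regular mA Aoo e0.
  pose G m := [set P | [/\ F m P, P `<=` E & real_average P <= a]].
  pose U m : set T := \bigcup_(P in G m) (P `&` core).
  have cG m : countable (G m).
    apply: sub_countable (filtration_countable HF m).
    by apply: subset_card_le => P [].
  have mU m : measurable (U m).
    apply: countable_bigcup_measurable => // P [FP _ _].
    by apply: measurableI => //; exact: measurable_generation FP.
  have UO m : U m `<=` E by move=> x [P [_ PO _] [Px _]]; exact: PO.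
  (* Points of [A] in [E] whose cells lie in [E] from generation [j] on. These sets increase to the
     intersection of [A] and [E], whereas the [U m] need not be monotone. *)
  pose W j : set T := (A `&` E) `&` \bigcap_(m in [set m | (j <= m)%N]) U m.
  have mW j : measurable (W j).
    apply: measurableI; first exact: measurableI.
    by apply: bigcap_measurable => [|k _]; [exists j => /=|exact: mU].
  have WA j : W j `<=` A by move=> x [[]].
  have WE : \bigcup_j W j = A `&` E.
    apply/seteqP; split => [x [j _ []//]|x [Ax Ox]].
    have [d d0 dO] := openO _ Ox; have [cx _ xa] := Ax.
    have [j jd] := cell_shrinks d0 cx.
    exists j => //; split => // m jm; have [FP Px] := cell_generation m cx.
    exists (cell m x) => //; split => //.
      by move=> y xy; apply: dO => i; exact: jd jm _ _ xy.
    by rewrite (le_trans _ (xa m))//; exact: (@cell_average_le_max m m).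
  have AOE : mu A = mu (A `&` E) 
    by apply: etrans (measureDI mu mA mO) _; rewrite -[RHS]add0e; congr (_ + _)%E.
  have bW j : (b%:E * mu (W j) <= a%:E * (mu A + e%:E))%E.
    apply: (@le_trans _ _ (\int[mu]_(x in W j) (g x)%:E)%E).
      rewrite -(integral_cst mu (mW j)); apply: le_integral_lower => x /WA[_ bx _].
        by rewrite lee_fin (le_trans a0)// ltW.
      by rewrite lee_fin ltW.
    apply: (@le_trans _ _ (\int[mu]_(x in U j) (g x)%:E)%E).
      apply: ge0_subset_integral => //; first by move=> x _; rewrite lee_fin.
      by move=> x [_]; apply => /=.
    apply: (@le_trans _ _ (\int[mu]_(x in U j) (cst a%:E) x)%E); last first.
      rewrite integral_cst//; apply: lee_wpmul2l; rewrite ?lee_fin//.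
      by apply: le_trans Oe; apply: le_measure; rewrite ?inE.
    apply: le_integral_pieces => //.
    - by move=> P [FP _ _]; apply: measurableI => //; exact: measurable_generation FP.
    - by move=> P P' [FP _ _] [FP' _ _]; exact: trivIset_core FP FP'.
    - by move=> x _; rewrite lee_fin.
    - move=> P [FP _ Pa]; have mP := measurable_generation FP.
      have mPc : measurable (P `&` core : set T) by exact: measurableI.
      have /andP[v0 _] := real_average_itv FP.
      rewrite (eq_integral (fun x : T => (0 + 1 * g x)%:E)); last first.
        by move=> x _; rewrite add0r mul1r.
      rewrite [leRHS](eq_integral (fun x : T => (a + 0 * g x)%:E)); last first.
        by move=> x _; rewrite mul0r addr0.
      rewrite (integral_affine_core FP (lexx 0) ler01).
      rewrite (integral_affine_core FP a0 (lexx 0)) add0r mul1r mul0r addr0.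
      by apply: lee_wpmul2r; rewrite ?measure_ge0// lee_fin.
  have b0 : 0 < b by exact: le_lt_trans ab.
  have cW : mu (W j) @[j --> \oo] --> mu (\bigcup_j W j).
    apply: nondecreasing_cvg_mu => //; first exact: bigcupT_measurable.
    move=> i j ij; apply/subsetPset => x [AEx Ux]; split => // m /= jm.
    by apply: Ux; exact: leq_trans jm.
  rewrite [in leLHS]AOE -WE -lee_pdivlMl//; apply: (cvge_to_le cW).
  by near=> j; rewrite lee_pdivlMl.
have : (0 <= mu A)%E by exact: measure_ge0.
move: Aoo key; case: (mu A) => [r|//|//] _ key; rewrite lee_fin => r0.
congr EFin; apply/eqP; rewrite eq_le r0 andbT leNgt; apply/negP => r_gt0.
(* Then [a * e < e * (a + 1) = (b - a) * r], contradicting [b * r <= a * (r + e)]. *)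
pose e := (b - a) * r / (a + 1).
have eE : e * (a + 1) = (b - a) * r by rewrite divfK// gt_eqF// ltr_wpDl.
have e0 : 0 < e by rewrite divr_gt0 ?mulr_gt0 ?subr_gt0// ltr_wpDl.
have := key e e0; rewrite -EFinD -!EFinM lee_fin; lra.
Unshelve. all: by end_near. Qed.

Lemma powR_le_lim_max_average x : core x ->
  (forall a b : rat, 0 <= a -> a < b -> ~ stalled (ratr a) (ratr b) x) ->
  ((g x `^ p)%:E <= limn (fun m => (g x * max_average m x `^ (p - 1))%:E))%E.
Proof.
move=> cx nst; set u := fun m => _.
have u_nd : nondecreasing_seq u.
  move=> k m km; rewrite lee_fin ler_wpM2l// ge0_ler_powR ?nnegrE//.
  - by case/andP: (max_average_itv k cx).
  - by case/andP: (max_average_itv m cx).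
  - exact: max_average_nd.
have uL m : (u m <= limn u)%E.
  rewrite (cvg_lim _ (ereal_nondecreasing_cvgn u_nd))//.
  by apply: ereal_sup_ubound; exists m.
have [gx0|gx0] := eqVneq (g x) 0.
  rewrite gx0 powR0 ?gt_eqF//; apply: le_trans (uL 0%N).
  by rewrite /u gx0 mul0r.
have gx : 0 < g x by rewrite lt_def gx0 g0.
have p1_gt0 : 0 < p - 1 by rewrite subr_gt0.
move: (limn u) uL => [l||] uL; last 2 first.
- by rewrite leey.
- by have := uL 0%N; rewrite leeNy_eq.
rewrite lee_fin leNgt; apply/negP => lg.
(* If the limit [l] were below [g(x)^p], all running maxima would be at most [t < g x], and two
   rationals strictly between [t] and [g x] would make [x] stalled. *)
pose c := l / g x; pose t := c `^ (p - 1)^-1.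
have Nc m : max_average m x `^ (p - 1) <= c.
  by rewrite ler_pdivlMr// mulrC -lee_fin; exact: uL.
have c0 : 0 <= c by rewrite (le_trans _ (Nc 0%N))// powR_ge0.
have tE : t `^ (p - 1) = c by rewrite -powRrM mulVf ?gt_eqF// powRr1.
have Nt m : max_average m x <= t.
  have /andP[N0 _] := max_average_itv m cx.
  rewrite -[leLHS]powRr1// -(@mulfV _ (p - 1)) ?gt_eqF// powRrM.
  by rewrite ge0_ler_powR ?nnegrE ?powR_ge0 ?invr_ge0.
have tg : t < g x.
  rewrite ltNge; apply/negP => gt; move: lg; rewrite ltNge => /negP; apply.
  rewrite -mulr_powRB1// -ler_pdivlMl// mulrC -/c -tE.
  by rewrite ge0_ler_powR ?nnegrE ?powR_ge0.
have [b] := rat_in_itvoo tg; rewrite in_itv/= => /andP[tb bg].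
have [a] := rat_in_itvoo tb; rewrite in_itv/= => /andP[ta ab].
apply: (nst a b).
- by rewrite -(ler_rat R) rmorph0 (le_trans _ (ltW ta))// powR_ge0.
- by rewrite -(ltr_rat R).
- by split => // m; rewrite (le_trans (Nt m))// ltW.
Qed.

(** Monotone convergence in [integral_max_average_ge]: each running maximum is below the maximal
    function, and off a null set the limit of [g N_m^(p-1)] is at least [g^p]. *)
Lemma integral_maximal_ge :
  (C%:E * \int[mu]_(x in (Q : set T)) (g x `^ p)%:E <=
   \int[mu]_x (`|maximal QQ g x| `^ p) +
   ((C - 1) * real_average Q `^ p)%:E * mu Q)%E.
Proof.
have mQ : measurable (Q : set T).
  by apply: (@measurable_generation 0); rewrite (filtration0 HF).
have mgc : measurable_fun core (g : T -> R) by exact: measurable_funTS.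
have mgp (D : set T) : measurable_fun D (fun x => (g x `^ p)%:E).
  apply/measurable_EFinP; apply: (measurableT_comp (measurable_powR p)).
  exact: measurable_funTS.
have gp0 (D : set T) (x : T) : D x -> (0 <= (g x `^ p)%:E)%E.
  by rewrite lee_fin powR_ge0.
pose h m (x : T) := (g x * max_average m x `^ (p - 1))%:E.
have mh m : measurable_fun core (h m).
  by apply/measurable_EFinP; exact: (measurable_funM mgc (mpow m (p - 1))).
have h0 m (x : T) : core x -> (0 <= h m x)%E.
  by rewrite lee_fin (mulr_ge0 (g0 _))// powR_ge0.
have h_nd (x : T) : core x -> {homo h^~ x : k m / (k <= m)%N >-> (k <= m)%E}.
  move=> cx k m km; rewrite lee_fin ler_wpM2l// ge0_ler_powR ?nnegrE//.
  - by case/andP: (max_average_itv k cx).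
  - by case/andP: (max_average_itv m cx).
  - exact: max_average_nd.
have hle m : (C%:E * \int[mu]_(x in core) h m x <=
   \int[mu]_x (`|maximal QQ g x| `^ p) + ((C - 1) * real_average Q `^ p)%:E * mu Q)%E.
  apply: (le_trans (integral_max_average_ge m)); apply: leeD => //.
  apply: le_integral_lower_subset => // x cx;
    [by rewrite lee_fin powR_ge0| |exact: poweR_ge0].
  have /andP[N0 _] := max_average_itv m cx.
  rewrite -poweR_EFin gt0_ler_poweR ?(ltW p0)//.
  - by rewrite in_itv/= lee_fin N0 leey.
  - by rewrite in_itv/= abse_ge0 leey.
  - by rewrite (le_trans (max_average_le_maximal m cx))// lee_abs.
pose S : set T := \bigcup_(q in [set q : rat * rat | 0 <= q.1 /\ q.1 < q.2])
  stalled (ratr q.1) (ratr q.2).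
have mS : measurable S.
  by apply: countable_bigcup_measurable => // q _; exact: measurable_stalled.
have S0 : mu S = 0%E.
  apply: measure_negligible => //; apply: countable_bigcup_negligible => // q [q0 qq].
  apply/negligibleP; first exact: measurable_stalled.
  by apply: stalled_null; [rewrite ler0q|rewrite ltr_rat].
have gh : (\int[mu]_(x in (Q : set T)) (g x `^ p)%:E <=
    \int[mu]_(x in core) limn (h^~ x))%E.
  rewrite (ge0_negligible_integral measurable_overlap mQ (mgp _) (gp0 _) overlap_null).
  rewrite (ge0_negligible_integral mS mcore (mgp _) (gp0 _) S0).
  apply: le_integral_lower_subset.
  - exact: subDsetl.
  - exact: gp0.
  - move=> x [cx Sx]; apply: powR_le_lim_max_average => // a b a0 ab st.
    by apply: Sx; exists (a, b).
  - move=> x cx; apply: lime_ge.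
      by apply: ereal_nondecreasing_is_cvgn => k m; exact: h_nd.
    by near=> m; exact: h0.
have C_gt0 : 0 < C by exact: lt_le_trans ltr01 (sharp_constant_ge1 p1 l1).
apply: (le_trans (lee_wpmul2l _ gh)); first by rewrite lee_fin.
rewrite -lee_pdivlMl//; apply: (cvge_to_le (cvg_monotone_convergence mcore mh h0 h_nd)).
by near=> m; rewrite lee_pdivlMl.
Unshelve. all: by end_near. Qed.

End filtration.

(** * From one body to the whole space *)

Section maximal_lower_bound.
Context {R : realType} {n : nat}.
Local Notation V := 'rV[R]_n.+1.
Local Notation T := (lebesgue_space R n).
Local Notation mu := (@lebesgue_measure_rV R n).
Implicit Types (f g : V -> R) (K P : set V) (QQ : set (set V)).

Lemma cube_sub (r s : R) : r <= s -> @cube R n r `<=` cube s.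
Proof.
move=> rs x xr i; have /andP[] := xr i; rewrite !mxE => rx xr'.
by rewrite (le_trans _ rx) ?lerN2// (le_trans xr').
Qed.

Lemma cube_exhausts x : exists k, forall m, (k <= m)%N -> @cube R n m%:R x.
Proof.
have [r r0 xr] := compact_sub_cube (@compact_set1 _ x).
exists (Num.Def.archi_bound r) => m km; apply: (@cube_sub r); last exact: xr.
by rewrite (le_trans (ltW (archi_boundP r0)))// ler_nat.
Qed.

Lemma integral_support (D : set T) (h : V -> \bar R) : (forall x, ~ D x -> h x = 0%E) ->
  (\int[mu]_x h x = \int[mu]_(x in D) h x)%E.
Proof.
move=> hD; rewrite [RHS]integral_mkcond; apply: eq_integral => x _.
by rewrite patchE; case: ifPn => // /negP xD; apply: hD => Dx; apply: xD; rewrite inE.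
Qed.

(** Since [f] is nonnegative only almost everywhere, [g] is compared with its positive part, which
    has the same integral over [K]. *)
Lemma average_le_compact f g K : compact K ->
  measurable_fun [set: T] (f : T -> R) -> nonneg_ae f ->
  (forall x, 0 <= g x) -> (forall x, g x <= Num.max (f x) 0) ->
  (average g K <= average f K)%E.
Proof.
move=> cK mf f0 g0 gf; rewrite /average; case: ifPn => // _.
have mK := compact_measurable_rV cK; apply: lee_wpmul2l; first by rewrite inve_ge0.
have fE : (\int[mu]_(x in (K : set T)) (f x)%:E =
    \int[mu]_(x in (K : set T)) (Num.max (f x) 0)%:E)%E.
  apply: ae_eq_integral; first exact: mK.
  - by apply/measurable_EFinP; exact: measurable_funTS.
  - apply/measurable_EFinP; apply: measurable_funTS.
    by apply: measurable_maxr; [exact: mf|exact: measurable_cst].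
  - by apply: (negligibleS _ f0) => x /= + fx; apply => _; rewrite (max_idPl _).
rewrite fE; apply: le_integral_lower => x _; rewrite lee_fin; [exact: g0|exact: gf].
Qed.

(** Exhaustiveness puts [x] in some body, so the supremum is not over the empty set and the maximal
    function of [g] is nonnegative; the absolute values then disappear. *)
Lemma abse_maximal_le QQ f g x : QQ `<=` [set K | compact K] -> exhaustive QQ ->
  measurable_fun [set: T] (f : T -> R) -> nonneg_ae f ->
  (forall x, 0 <= g x) -> (forall x, g x <= Num.max (f x) 0) ->
  (`|maximal QQ g x| <= `|maximal QQ f x|)%E.
Proof.
move=> cQQ eQQ mf f0 g0 gf; have gM : (0 <= maximal QQ g x)%E.
  have [Q QQQ xQ] := eQQ _ (@compact_set1 _ x).
  apply: (@le_trans _ _ (average g Q)); last first.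
    by apply: ereal_sup_ubound; exists Q => //; split => //; exact: xQ.
  rewrite /average; case: ifPn => // _; apply: mule_ge0; first by rewrite inve_ge0.
  by apply: integral_ge0 => y _; rewrite lee_fin.
have gfM : (maximal QQ g x <= maximal QQ f x)%E.
  apply: ge_ereal_sup => _ [Q [QQQ Qx] <-].
  apply: (@le_trans _ _ (average f Q)).
    by apply: average_le_compact => //; exact: cQQ.
  by apply: ereal_sup_ubound; exists Q.
by rewrite (gee0_abs gM) (gee0_abs (le_trans gM gfM)).
Qed.

(** If [Q] contains the support of [g], then [A |Q| = i] for [A] the average over [Q] and [i] the
    integral of [g]. The error [(C - 1) A^p |Q|] is thus [(C - 1) i A^(p-1)], small for large [|Q|]
    because [p > 1]. *)
Lemma integral_maximal_bounded_ge QQ (p lambda M r : R) g : 1 < p -> 1 < lambda ->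
  QQ `<=` [set K | compact K] -> exhaustive QQ -> dense_family lambda QQ ->
  measurable_fun [set: T] (g : T -> R) -> (forall x, 0 <= g x) -> (forall x, g x <= M) ->
  (forall x, ~ cube r x -> g x = 0) ->
  ((sharp_constant p lambda)%:E * \int[mu]_x (g x `^ p)%:E <=
   \int[mu]_x (`|maximal QQ g x| `^ p))%E.
Proof.
move=> p1 l1 cQQ eQQ dQQ mg g0 gM gr; set C := sharp_constant p lambda.
have p_gt0 : 0 < p by exact: lt_trans ltr01 p1.
have p1_gt0 : 0 < p - 1 by rewrite subr_gt0.
have M0 : 0 <= M by exact: le_trans (g0 0) (gM 0).
have C1 : 0 <= C - 1 by rewrite subr_ge0 sharp_constant_ge1.
have int_lt K : compact K -> (\int[mu]_(x in (K : set T)) (g x)%:E < +oo)%E.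
  move=> cK; have mK := compact_measurable_rV cK.
  apply: (@le_lt_trans _ _ (M%:E * mu K)%E).
    rewrite -(integral_cst mu mK); apply: le_integral_lower => x _.
      by rewrite lee_fin.
    by rewrite lee_fin.
  by rewrite lte_mul_pinfty ?lee_fin//; exact: compact_lebesgue_lty.
have lg : locally_integrable_rV g.
  split=> // K cK; rewrite (eq_integral (fun x : T => (g x)%:E)); first exact: int_lt.
  by move=> x _; rewrite ger0_norm.
have intg0 : (0 <= \int[mu]_(x in (cube r : set T)) (g x)%:E)%E.
  by apply: integral_ge0 => x _; rewrite lee_fin.
have [i i0 intg] : exists2 i : R, 0 <= i & (\int[mu]_x (g x)%:E)%E = i%:E.
  rewrite (integral_support (D := cube r)); last by move=> x /gr ->.
  move: intg0 (int_lt _ (@compact_cube _ _ r)).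
  by case: (integral _ _ _) => [i|//|//]; rewrite lee_fin => i0 _; exists i.
apply/lee_addgt0Pr => e e0.
pose c := (C - 1) * i; have c0 : 0 <= c by rewrite mulr_ge0.
(* An average of at most [d] makes the error at most [c * e / (c + 1) <= e]; adding 1 covers the
   case [c = 0]. *)
pose d := (e / (c + 1)) `^ (p - 1)^-1.
have ec0 : 0 < e / (c + 1) by rewrite divr_gt0// ltr_wpDl.
have d0 : 0 < d by rewrite powR_gt0.
(* With [s >= r] the cube contains the support; [s >= 1] gives it measure [(2 s)^(n+1) >= s];
   [s >= i / d] then forces the average below [d]. *)
pose s := Num.max 1 (Num.max r (i / d)).
have [s1 rs ids] : [/\ 1 <= s, r <= s & i / d <= s].
  by rewrite /s !le_max !lexx !orbT.
have [Q QQQ sQ] := eQQ _ (@compact_cube _ _ s).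
have g0ae : nonneg_ae g by apply: aeW => x; exact: g0.
have [F [ch HF]] := dQQ g Q lg g0ae QQQ.
have FQ : F 0%N Q by rewrite (filtration0 HF).
have := integral_maximal_ge p1 l1 cQQ mg g0 gM HF.
have supp x : ~ Q x -> g x = 0.
  by move=> Qx; apply: gr => rx; apply/Qx/sQ; exact: cube_sub rx.
rewrite -(integral_support (D := Q)); last by move=> x /supp ->; rewrite powR0// gt_eqF.
move=> /le_trans; apply; apply: leeD => //.
have /andP[A0 _] := real_average_itv cQQ mg g0 gM HF FQ.
have := integral_average cQQ mg g0 gM HF FQ.
rewrite -integral_support; last by move=> x /supp ->.
rewrite intg.
have mQ := compact_measurable_rV (cQQ _ QQQ).
have : (s%:E <= mu Q)%E.
  apply: (@le_trans _ _ (mu (cube s))).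
    rewrite lebesgue_cube; last by rewrite (le_trans ler01).
    rewrite lee_fin exprS (@le_trans _ _ (2 * s))//; first by lra.
    by rewrite ler_peMr ?exprn_ege1//; lra.
  by apply: le_measure; rewrite ?inE//; exact: measurable_box.
have := compact_lebesgue_lty (cQQ _ QQQ).
case: (mu Q) => [q _|//|_]; last by rewrite leeNy_eq.
rewrite lee_fin => sq; rewrite -EFinM => -[iE].
set A := real_average g Q in A0 iE *.
have q0 : 0 < q by lra.
have Ad : A <= d.
  rewrite -(ler_pM2r q0) -iE -ler_pdivrMl//  mulrC.
  exact: le_trans ids sq.
have Ae : A `^ (p - 1) <= e / (c + 1).
  have -> : e / (c + 1) = d `^ (p - 1).
    by rewrite -powRrM mulVf ?gt_eqF// powRr1// ltW.
  by rewrite ge0_ler_powR ?nnegrE// ltW.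
rewrite -EFinM lee_fin -mulr_powRB1//.
have -> : (C - 1) * (A * A `^ (p - 1)) * q = c * A `^ (p - 1).
  by rewrite /c iE; ring.
apply: (@le_trans _ _ (c * (e / (c + 1)))); first by rewrite ler_wpM2l.
by rewrite mulrA ler_pdivrMr ?ltr_wpDl//; nra.
Qed.

End maximal_lower_bound.

(** * Bounded truncations with compact support *)

Section truncation.
Context {R : realType} {n : nat}.
Local Notation V := 'rV[R]_n.+1.
Local Notation T := (lebesgue_space R n).
Local Notation mu := (@lebesgue_measure_rV R n).
Context (f : V -> R) (mf : measurable_fun [set: T] (f : T -> R)).

(** The positive part makes the truncation nonnegative everywhere, while [f] is so only almost
    everywhere. *)
Definition truncation (k : nat) (x : V) : R :=
  \1_(@cube R n k%:R) x * Num.min (Num.max (f x) 0) k%:R.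

Let min_ge0 k x : 0 <= Num.min (Num.max (f x) 0) k%:R.
Proof. by rewrite le_min le_max lexx orbT ler0n. Qed.

Lemma truncation_ge0 k x : 0 <= truncation k x.
Proof. by rewrite mulr_ge0. Qed.

Lemma truncation_le k x : truncation k x <= k%:R.
Proof.
rewrite -[leRHS]mul1r ler_pM ?min_ge0// ?ge_min ?lexx ?orbT//.
Qed.

Lemma truncation_le_max k x : truncation k x <= Num.max (f x) 0.
Proof.
rewrite -[leRHS]mul1r ler_pM ?min_ge0// ?ge_min ?lexx//.
Qed.

Lemma truncation_eq0 k x : ~ cube k%:R x -> truncation k x = 0.
Proof. by move=> kx; rewrite /truncation indicE memNset// mul0r. Qed.

Lemma truncation_nd x : {homo truncation^~ x : k m / (k <= m)%N >-> k <= m}.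
Proof.
move=> k m km; have km' : (k%:R : R) <= m%:R by rewrite ler_nat.
rewrite ler_pM ?min_ge0//; last by rewrite le_min !ge_min lexx km' orbT.
rewrite !indicE; case: (boolP (x \in cube k%:R)) => [xk|_]; last by rewrite ler0n.
by rewrite mem_set//; apply: cube_sub km' _ _; exact: set_mem.
Qed.

Lemma truncation_near x : \forall k \near \oo, truncation k x = Num.max (f x) 0.
Proof.
have [k kx] := cube_exhausts x.
have fx0 : 0 <= Num.max (f x) 0 by rewrite le_max lexx orbT.
exists (maxn k (Num.Def.archi_bound (Num.max (f x) 0))) => // m /=.
rewrite geq_max => /andP[km fm]; rewrite /truncation indicE mem_set ?mul1r; last exact: kx.
by rewrite (min_idPl _)// (le_trans (ltW (archi_boundP fx0)))// ler_nat.
Qed.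

Lemma measurable_truncation k : measurable_fun [set: T] (truncation k : T -> R).
Proof.
apply: measurable_funM.
  by apply: measurable_indic; exact: measurable_box.
apply: measurable_minr; last exact: measurable_cst.
by apply: measurable_maxr; [exact: mf|exact: measurable_cst].
Qed.

End truncation.

(** * The lower bound for general functions *)

Theorem theorem2 (R : realType) (n : nat) (p lambda : R)
    (QQ : set (set 'rV[R]_n.+1)) :
  1 < p -> 1 < lambda ->
  QQ `<=` [set Q | convex_body Q] ->
  exhaustive QQ ->
  dense_family lambda QQ ->
  forall f : lebesgue_space R n -> R,
    measurable_fun [set: lebesgue_space R n] f ->
    finite_norm (lebesgue_measure_rV R n) p%:E f ->
    nonneg_ae f ->
    ((((lambda `^ p - 1) / (lambda `^ p - lambda)) `^ p^-1)%:E
       * 'N[lebesgue_measure_rV R n]_p%:E[EFin \o f]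
     <= 'N[lebesgue_measure_rV R n]_p%:E[maximal QQ f])%E.
Proof.
move=> p1 l1 bodyQQ eQQ dQQ f mf _ f0.
pose mu := lebesgue_measure_rV R n.
have cQQ : QQ `<=` [set K | compact K] by move=> K /bodyQQ[].
have p_gt0 : 0 < p by exact: lt_trans ltr01 p1.
have C1 := sharp_constant_ge1 p1 l1.
have C_gt0 : 0 < sharp_constant p lambda by exact: lt_le_trans ltr01 C1.
pose h k (x : lebesgue_space R n) := (truncation f k x `^ p)%:E.
have mh k : measurable_fun [set: lebesgue_space R n] (h k).
  apply/measurable_EFinP; apply: (measurableT_comp (measurable_powR p)).
  exact: measurable_truncation.
have h0 k (x : lebesgue_space R n) : [set: lebesgue_space R n] x -> (0 <= h k x)%E.
  by rewrite lee_fin powR_ge0.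
have h_nd (x : lebesgue_space R n) : [set: lebesgue_space R n] x ->
    {homo h^~ x : k m / (k <= m)%N >-> (k <= m)%E}.
  move=> _ k m km; rewrite lee_fin ge0_ler_powR ?nnegrE ?(ltW p_gt0) ?truncation_ge0//.
  exact: truncation_nd.
have hM k : ((sharp_constant p lambda)%:E * \int[mu]_x h k x <=
    \int[mu]_x (`|maximal QQ f x| `^ p))%E.
  apply: (@le_trans _ _ (\int[mu]_x (`|maximal QQ (truncation f k) x| `^ p))%E).
    apply: (integral_maximal_bounded_ge (M := k%:R) (r := k%:R)) => //.
    - exact: measurable_truncation.
    - exact: truncation_ge0.
    - exact: truncation_le.
    - exact: truncation_eq0.
  apply: le_integral_lower => x _; first exact: poweR_ge0.
  rewrite gt0_ler_poweR ?(ltW p_gt0)// ?in_itv/= ?abse_ge0 ?leey//.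
  apply: abse_maximal_le => //; first exact: truncation_ge0.
  exact: truncation_le_max.
have hlim x : limn (h^~ x) = (Num.max (f x) 0 `^ p)%:E.
  apply: lim_near_cst => //; have [k _ kx] := truncation_near f x.
  by exists k => // m /kx mx; rewrite /h mx.
(* The truncations converge to the positive part of [f], which agrees with [|f|] almost
   everywhere. *)
have fE : (\int[mu]_x (`|(f x)%:E| `^ p) = \int[mu]_x limn (h^~ x))%E.
  rewrite [RHS](eq_integral (fun x => (Num.max (f x) 0 `^ p)%:E)); last first.
    by move=> x _; exact: hlim.
  apply: ae_eq_integral; first exact: measurableT.
  - apply: (measurableT_comp (measurable_poweR p)).
    by apply: measurableT_comp; [exact: abse_measurable|exact/measurable_EFinP].
  - apply/measurable_EFinP; apply: (measurableT_comp (measurable_powR p)).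
    by apply: measurable_maxr; [exact: mf|exact: measurable_cst].
  - apply: (negligibleS _ f0) => x /= + fx; apply => _.
    by rewrite (max_idPl fx) ger0_norm.
rewrite unlock /=.
have Mp0 : (0 <= \int[mu]_x (`|maximal QQ f x| `^ p))%E.
  by apply: integral_ge0 => x _; exact: poweR_ge0.
have fp0 : (0 <= \int[mu]_x (`|(f x)%:E| `^ p))%E.
  by apply: integral_ge0 => x _; exact: poweR_ge0.
(* Moving the constant under the power [1/p] reduces the claim to the inequality between the
   integrals of [p]-th powers. *)
rewrite -poweR_EFin -poweRM// ?lee_fin ?(ltW C_gt0)//.
apply: gt0_ler_poweR.
- by rewrite invr_ge0 ltW.
- by rewrite in_itv/= leey andbT mule_ge0// lee_fin ltW.
- by rewrite in_itv/= leey andbT.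
rewrite fE -lee_pdivlMl//.
apply: (cvge_to_le (cvg_monotone_convergence measurableT mh h0 h_nd)).
by near=> k; rewrite lee_pdivlMl.
Unshelve. all: by end_near. Qed.
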